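(* The operator $(A+B, D(A))$ is closable in $X$ and its closure $G=\overline{A+B}$ generates a substochastic semigroup $\{S_G(t)\}_{t\ge 0}$ on $X$. If, in addition, $$\limsup_{n\to\infty}\frac{a_n}{d_n}<\infty,$$ then $D(G)=D(A)$.
   Context: Indices $n,i,j$ range over the positive integers. Let $(r_i)_{i\ge1},(d_i)_{i\ge1},(a_i)_{i\ge1}$ be real sequences with $r_i>0$ and $d_i\ge0$ for all $i\ge 1$, $a_1=0$, and $a_i>0$ for $i\ge2$. Let $b_{i,j}\ge0$ satisfy $b_{i,j}=0$ for $i\ge j$ and $\sum_{i=1}^{j-1} i\,b_{i,j}=j$ for all $j\ge2$. Put $\theta_i=r_i+a_i+d_i$ and $p_i=a_i+d_i$. Let $X=\{f=(f_n)_{n\ge1}:\ \|f\|=\sum_{n=1}^\infty n|f_n|<\infty\}$. For sequences $x,y$ write $xy=(x_ny_n)_n$; so e.g. $pf=(p_nf_n)_n$, $rf=(r_nf_n)_n$. For a sequence $f$ let $\triangle f=(f_1,(f_{n-1}-f_n)_{n\ge2})$. The decay operator $A$ is $[Af]_i=r_{i+1}f_{i+1}-\theta_i f_i$, $i\ge1$, with domain $$D(A)=\{f\in X:\ pf\in X,\ \triangle(rf)\in X,\ \lim_{n\to\infty}r_nf_n=0\}.$$ The operator $B$ is $[Bf]_i=\sum_{j=i+1}^\infty a_jb_{i,j}f_j$, $i\ge1$, considered on $D(A)$, where it takes values in $X$. A substochastic semigroup is a $C_0$-semigroup of positive (with respect to the cone of nonnegative sequences) contractions. The condition $\limsup_{n\to\infty}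 a_n/d_n<\infty$ is understood to include that $d_n>0$ for all sufficiently large $n$. *)

(* Defs.v *)
From HB Require Import structures.
From mathcomp Require Import all_boot all_order all_algebra.
From mathcomp Require Import all_classical all_reals all_analysis.
From mathcomp Require Import ring.

Set Implicit Arguments.
Unset Strict Implicit.
Unset Printing Implicit Defensive.

Import Order.TTheory GRing.Theory Num.Theory.
Import numFieldNormedType.Exports.

Local Open Scope classical_set_scope.
Local Open Scope ring_scope.

(* A sequence (f_n)_{n >= 1} is encoded as a function f : nat -> R with
   f k = f_{k+1}.  In particular the weight n becomes k.+1%:R, the entry
   b_{i,j} becomes b i j with both indices shifted, and a_1 = 0 reads
   a 0 = 0. *)

Lemma nneseries_ge_term (R : realType) (u : nat -> \bar R) k :
  (forall i, 0 <= u i)%E -> (u k <= \sum_(i <oo) u i)%E.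
Proof.
move=> u0; apply: le_trans (nneseries_lim_ge k.+1 (fun i _ _ => u0 i)).
by rewrite big_nat_recr//= leeDr// sume_ge0.
Qed.

Lemma abs_series (R : realType) (u : nat -> R) :
  (\sum_(j <oo) `|u j|%:E < +oo)%E ->
  cvgn (series u) /\ (`|limn (series u)|%:E <= \sum_(j <oo) `|u j|%:E)%E.
Proof.
move=> uoo; have u0 j : (0 <= `|u j|%:E)%E by rewrite lee_fin.
set s := (X in (X < _)%E) in uoo *.
have sE : ((fine s)%:E = s)%E by rewrite fineK// ge0_fin_numE// nneseries_ge0.
have us n : \sum_(0 <= j < n) `|u j| <= fine s.
  by rewrite -lee_fin sE -sumEFin; exact: nneseries_lim_ge.
have cu : cvgn (series u).
  apply: normed_cvg; apply: nondecreasing_is_cvgn.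
    exact: (@nondecreasing_series _ (fun j => `|u j|) xpredT 0%N
      (fun n _ _ => normr_ge0 _)).
  by exists (fine s) => _ [n _ <-]; exact: us.
split=> //; rewrite -[leRHS]sE lee_fin -lim_norm//; apply: limr_le.
  exact: is_cvg_norm.
by apply: nearW => n /=; exact: le_trans (ler_norm_sum _ _ _) (us n).
Qed.

Section weighted_l1.
Variable R : realType.

Definition wnorm (f : nat -> R) : \bar R :=
  (\sum_(k <oo) (k.+1%:R * `|f k|)%:E)%E.

Definition wl1 : {pred nat -> R} := [pred f | (wnorm f < +oo)%E].

Record ellw : Type := Ellw { ellw_val :> nat -> R ; _ : ellw_val \in wl1 }.

HB.instance Definition _ := [isSub for ellw_val].
HB.instance Definition _ := [Choice of ellw by <:].

Lemma wnorm_ge0 (f : nat -> R) : (0 <= wnorm f)%E.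
Proof.
by apply: nneseries_ge0 => k _ _; rewrite lee_fin mulr_ge0.
Qed.

Lemma wnorm0 : wnorm (0 : nat -> R) = 0%E.
Proof. by apply: eseries0 => k _ _ /=; rewrite normr0 mulr0. Qed.

Lemma le_wnorm (f g : nat -> R) : (forall k, `|f k| <= `|g k|) -> (wnorm f <= wnorm g)%E.
Proof.
move=> fg; apply: lee_nneseries => k; first by rewrite lee_fin mulr_ge0.
by move=> _; rewrite lee_fin ler_pM.
Qed.

Lemma wnormD (f g : nat -> R) :
  (wnorm (f + g)%R <= wnorm f + wnorm g)%E.
Proof.
rewrite /wnorm -nneseriesD; last 2 first.
- by move=> k _ _; rewrite lee_fin mulr_ge0.
- by move=> k _ _; rewrite lee_fin mulr_ge0.
apply: lee_nneseries => k; first by rewrite lee_fin mulr_ge0.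
by move=> _; rewrite -EFinD lee_fin -mulrDr ler_pM ?ler_normD.
Qed.

Lemma wnormZ (c : R) (f : nat -> R) :
  (wnorm (c *: f)%R = `|c|%:E * wnorm f)%E.
Proof.
rewrite /wnorm -nneseriesZl; last by move=> k _; rewrite lee_fin mulr_ge0.
apply: eq_eseriesr => k _ /=.
have -> : (c *: f) k = c * f k by [].
by rewrite -EFinM normrM mulrCA.
Qed.

Lemma wl1_submod_closed : submod_closed wl1.
Proof.
split=> [|c f g]; rewrite !inE/=; first by rewrite wnorm0.
move=> fX gX; apply: le_lt_trans (wnormD _ _) _.
by rewrite wnormZ lte_add_pinfty// lte_mul_pinfty// lee_fin.
Qed.

HB.instance Definition _ :=
  GRing.isSubmodClosed.Build R (nat -> R) wl1 wl1_submod_closed.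
HB.instance Definition _ := [SubChoice_isSubLmodule of ellw by <:].

Definition ellw_norm (f : ellw) : R := fine (wnorm f).

Lemma ellw_normE (f : ellw) : (ellw_norm f)%:E = wnorm f.
Proof.
rewrite /ellw_norm fineK// ge0_fin_numE ?wnorm_ge0//.
by have := valP f; rewrite inE.
Qed.

Lemma ellw_normD (f g : ellw) : ellw_norm (f + g) <= ellw_norm f + ellw_norm g.
Proof. by rewrite -lee_fin EFinD !ellw_normE; exact: wnormD. Qed.

Lemma ellw_normZ (c : R) (f : ellw) : ellw_norm (c *: f) = `|c| * ellw_norm f.
Proof. by apply: EFin_inj; rewrite EFinM !ellw_normE; exact: wnormZ. Qed.

Lemma ellw_norm0_eq0 (f : ellw) : ellw_norm f = 0 -> f = 0.
Proof.
move=> f0; apply/val_inj/funext => k /=.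
have : (wnorm f <= 0)%E by rewrite -ellw_normE f0.
have u_ge0 i : (0 <= (i.+1%:R * `|f i|)%:E)%E by rewrite lee_fin mulr_ge0.
move=> /(le_trans (nneseries_ge_term k u_ge0)).
rewrite lee_fin pmulr_rle0// normr_le0 => /eqP ->.
by [].
Qed.

HB.instance Definition _ :=
  Lmodule_isNormed.Build R ellw ellw_normD ellw_normZ ellw_norm0_eq0.

End weighted_l1.

Arguments wl1 {R}.

(* Unbounded, possibly multivalued, operators are identified with their
   graphs, so that the closure of an operator is the topological closure of
   its graph in V * V. *)
Section operators.
Variables (R : realType) (V : normedModType R).

Definition opdom (G : set (V * V)) : set V := fst @` G.

Definition closable (G : set (V * V)) : Prop :=
  forall x y z, closure G (x, y) -> closure G (x, z) -> y = z.

(* Only the values S t for 0 <= t are meaningful. *)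
Definition C0_semigroup (S : R -> V -> V) : Prop :=
  [/\ forall t, 0 <= t -> linear (S t),
      forall t, 0 <= t -> continuous (S t),
      forall x, S 0 x = x,
      forall s t x, 0 <= s -> 0 <= t -> S (s + t) x = S s (S t x) &
      forall x, S t x @[t --> 0^'+] --> x].

Definition generator (S : R -> V -> V) : set (V * V) :=
  [set xy | t^-1 *: (S t xy.1 - xy.1) @[t --> 0^'+] --> xy.2].

End operators.

Definition substochastic_semigroup (R : realType)
    (S : R -> ellw R -> ellw R) : Prop :=
  [/\ C0_semigroup S,
      forall t (f : ellw R), 0 <= t ->
        (forall k, 0 <= f k) -> forall k, 0 <= S t f k &
      forall t (f : ellw R), 0 <= t -> `|S t f| <= `|f|].

Section decay_fragmentation.
Variable R : realType.
Variables (r d a : nat -> R) (b : nat -> nat -> R).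

Definition theta (i : nat) : R := r i + a i + d i.

Definition prate (i : nat) : R := a i + d i.

Definition triangle (f : nat -> R) (n : nat) : R :=
  if n is m.+1 then f m - f m.+1 else f 0%N.

Definition decay (f : nat -> R) (i : nat) : R :=
  r i.+1 * f i.+1 - theta i * f i.

Definition frag (f : nat -> R) (i : nat) : R :=
  \big[+%R/0]_(i.+1 <= j <oo) (a j * b i j * f j).

Definition decay_dom : set (ellw R) :=
  [set f | [/\ prate \* f \in wl1,
               triangle (r \* f) \in wl1 &
               r n * f n @[n --> \oo] --> (0 : R)]].

Definition decayfrag : set (ellw R * ellw R) :=
  [set fg : ellw R * ellw R | decay_dom fg.1 /\
            forall i, fg.2 i = decay fg.1 i + frag fg.1 i].

(* Well-definedness: under the standing assumptions decay and frag map
   decay_dom into ellw, so that opdom decayfrag is exactly decay_dom. *)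

Hypothesis d_ge0 : forall i, 0 <= d i.
Hypothesis a0 : a 0%N = 0.
Hypothesis a_gt0 : forall i, (0 < i)%N -> 0 < a i.
Hypothesis b_ge0 : forall i j, 0 <= b i j.
Hypothesis b_eq0 : forall i j, (j <= i)%N -> b i j = 0.
Hypothesis b_mass : forall j, (0 < j)%N ->
  \sum_(0 <= i < j) i.+1%:R * b i j = j.+1%:R.

Let a_ge0 i : 0 <= a i.
Proof. by case: i => [|i]; rewrite ?a0// ltW// a_gt0. Qed.

Lemma decay_wl1 (f : ellw R) : decay_dom f -> decay f \in wl1.
Proof.
move=> [pf tf _].
have sf : (fun i => triangle (r \* f) i.+1) \in wl1.
  move: tf; rewrite !inE/=; apply: le_lt_trans.
  rewrite {2}/wnorm nneseries_recl//.
  apply: le_trans (leeDr _ _); last by rewrite lee_fin mulr_ge0.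
  rewrite -(@nneseries_addn _ _ 1%N); last first.
    by move=> k; rewrite lee_fin mulr_ge0.
  apply: lee_nneseries => k; first by rewrite lee_fin mulr_ge0.
  by move=> _; rewrite addn1 lee_fin ler_pM// ler_nat.
have -> : decay f = - ((fun i => triangle (r \* f) i.+1) + prate \* f).
  apply/funext => i; rewrite /decay /theta /prate/=.
  transitivity (- (r i * f i - r i.+1 * f i.+1 + (a i + d i) * f i)) => //.
  by ring.
by rewrite rpredN rpredD.
Qed.

Let frag_tonelli (f : nat -> R) :
  (\sum_(i <oo) \sum_(j <oo) (i.+1%:R * (a j * b i j * `|f j|))%:E
    <= wnorm (prate \* f)%R)%E.
Proof.
rewrite nneseries_interchange; last first.
  by move=> i j; rewrite lee_fin !mulr_ge0.
apply: lee_nneseries => [j _ _|j _].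
  by apply: nneseries_ge0 => i _ _; rewrite lee_fin !mulr_ge0.
have pf : a j * `|f j| <= `|(prate \* f) j|.
  by rewrite /= normrM ler_wpM2r// ger0_norm ?addr_ge0// lerDl.
have -> : (\sum_(i <oo) (i.+1%:R * (a j * b i j * `|f j|))%:E
   = \sum_(0 <= i < j) (i.+1%:R * (a j * b i j * `|f j|))%:E)%E.
  rewrite (@nneseries_split _ _ 0%N j); last first.
    by move=> i _; rewrite lee_fin !mulr_ge0.
  rewrite add0n eseries0 ?adde0// => i ji _.
  by rewrite b_eq0// mulr0 mul0r mulr0.
rewrite sumEFin lee_fin.
under eq_bigr do rewrite -mulrA mulrCA (mulrA _ (b _ _)) [_ * `|f j|]mulrC.
rewrite -mulr_sumr -mulr_sumr.
case: (posnP j) => [->|j0]; first by rewrite a0 mul0r mulr_ge0.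
by rewrite b_mass// mulrA mulrC ler_wpM2l.
Qed.

Let fragE (f : nat -> R) i :
  (fun n => \sum_(i.+1 <= j < n) (a j * b i j * f j)) =
  series (fun j => a j * b i j * f j).
Proof.
apply/funext => n; rewrite (@big_nat_widenl _ _ _ _ 0%N)//= big_mkcond.
apply: eq_bigr => j _; case: ltnP => //= ji.
by rewrite b_eq0// mulr0 mul0r.
Qed.

Let row_le (f : nat -> R) i :
  (\sum_(j <oo) (i.+1%:R * (a j * b i j * `|f j|))%:E <=
     wnorm (prate \* f)%R)%E.
Proof.
apply: le_trans (frag_tonelli f).
apply: (nneseries_ge_term
  (u := fun i => \sum_(j <oo) (i.+1%:R * (a j * b i j * `|f j|))%:E)%E i).
by move=> k; apply: nneseries_ge0 => j _ _; rewrite lee_fin !mulr_ge0.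
Qed.

Let row_fin (f : ellw R) i : decay_dom f ->
  (\sum_(j <oo) (`|a j * b i j * f j|)%:E < +oo)%E.
Proof.
move=> [pf _ _]; move: pf; rewrite inE/=; apply: le_lt_trans.
apply: le_trans (row_le f i).
apply: lee_nneseries => j; first by rewrite lee_fin.
move=> _; rewrite lee_fin normrM [`|a j * b i j|]ger0_norm ?mulr_ge0//.
by rewrite ler_peMl ?mulr_ge0// ler1n.
Qed.

Lemma frag_cvg (f : ellw R) i : decay_dom f ->
  cvgn (fun n => \sum_(i.+1 <= j < n) (a j * b i j * f j)).
Proof. by move=> fD; rewrite fragE; exact: (abs_series (row_fin i fD)).1. Qed.

Lemma frag_wl1 (f : ellw R) : decay_dom f -> frag f \in wl1.
Proof.
move=> fD; have [pf _ _] := fD; move: pf; rewrite !inE/=; apply: le_lt_trans.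
apply: le_trans (frag_tonelli f).
apply: lee_nneseries => i; first by rewrite lee_fin mulr_ge0.
move=> _; rewrite /frag fragE.
have [_ h] := abs_series (row_fin i fD).
have -> : (\sum_(j <oo) (i.+1%:R * (a j * b i j * `|f j|))%:E =
           i.+1%:R%:E * \sum_(j <oo) (`|a j * b i j * f j|)%:E)%E.
  rewrite -nneseriesZl//; apply: eq_eseriesr => j _.
  by rewrite -EFinM normrM [`|a j * b i j|]ger0_norm ?mulr_ge0.
by rewrite EFinM lee_wpmul2l// lee_fin.
Qed.

Lemma opdom_decayfrag : opdom decayfrag = decay_dom.
Proof.
apply/seteqP; split=> [_ [[f g] [fD _] <-]//|f fD].
have gX : decay f + frag f \in wl1.
  by rewrite rpredD ?decay_wl1 ?frag_wl1.
by exists (f, Ellw gX).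
Qed.

End decay_fragmentation.

(* Main.v *)
(* [A + B] is upper triangular, hence leaves invariant the space [F N] of the
   sequences supported in [0, N[, on which it agrees with a bounded operator
   [finsec N] of the whole space.  For small [h], mass balance makes
   [1 + h finsec N] a positive contraction, so the Euler products
   [(1 + t/n finsec N)^n] converge to a substochastic semigroup; these
   semigroups are consistent in [N] and, the union of the [F N] being dense,
   have a limit semigroup.  The finitely supported sequences form a core of its
   generator because [1 - finsec N] maps [F N] onto itself, and truncation shows
   that they also form a core of [(A + B, D(A))].

   The same mass balance gives [|| d f || <= || (A + B) f ||] for finitely
   supported [f].  If [a] is dominated by [d], the graph norm of [A + B] thus
   controls [p f] and [triangle (r f)] on the core, hence on the domain of the
   closure. *)

Require Import Defs.
From HB Require Import structures.
From mathcomp Require Import all_boot all_order all_algebra.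
From mathcomp Require Import all_classical all_reals all_analysis.
From mathcomp Require Import ring lra.

Set Implicit Arguments.
Unset Strict Implicit.
Unset Printing Implicit Defensive.

Import Order.TTheory GRing.Theory Num.Theory.
Import numFieldNormedType.Exports.

Local Open Scope classical_set_scope.
Local Open Scope ring_scope.

(** * Euler products of a bounded operator *)

(** Stated through differences, so that it applies to iterates and limits not packaged as linear
    maps. *)
Definition nonexpansive (R : realType) (V W : normedModType R) (f : V -> W) : Prop :=
  forall x y, `|f x - f y| <= `|x - y|.

Lemma nonexpansive_continuous (R : realType) (V W : normedModType R) (f : V -> W) :
  nonexpansive f -> continuous f.
Proof.
move=> f1 x; apply/cvgrPdist_le => e e0; near=> y.
apply: le_trans (f1 _ _) _; near: y.
exact: cvgr_dist_le.
Unshelve. all: by end_near. Qed.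

Section nonexpansive_maps.
Variables (R : realType) (V : normedModType R).

Lemma nonexpansive_iter (f : V -> V) m : nonexpansive f -> nonexpansive (iter m f).
Proof.
by move=> f1; elim: m => //= m IH x y; exact: le_trans (f1 _ _) (IH _ _).
Qed.

Lemma iter_commute (f g : V -> V) m : (forall x, f (g x) = g (f x)) ->
  forall x, f (iter m g x) = iter m g (f x).
Proof. by move=> fg; elim: m => //= m IH x; rewrite fg IH. Qed.

(* Telescoping: replace the [m] copies of [g] by [f] one at a time. *)
Lemma iter_nonexpansive_dist (f g : V -> V) m : nonexpansive f -> nonexpansive g ->
  (forall x, f (g x) = g (f x)) ->
  forall x, `|iter m f x - iter m g x| <= m%:R * `|f x - g x|.
Proof.
move=> f1 g1 fg; elim: m => [|m IH] x; first by rewrite subrr normr0 mul0r.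
rewrite !iterSr (le_trans (ler_distD (iter m f (g x)) _ _))//.
rewrite -natr1 mulrDl mul1r [leRHS]addrC lerD//; first exact: (nonexpansive_iter m f1).
by apply: le_trans (IH _) _; rewrite ler_wpM2l// fg.
Qed.

Lemma le_dist_lim (T : topologicalType) (F : set_system T) (FF : ProperFilter F)
    (u : T -> V) (B : T -> R) (l y : V) (c : R) :
  u t @[t --> F] --> l -> B t @[t --> F] --> c ->
  (\forall t \near F, `|u t - y| <= B t) -> `|l - y| <= c.
Proof.
by move=> ul Bc; apply: ler_cvg_to Bc; apply: cvg_norm; apply: cvgB ul (cvg_cst _).
Qed.

Lemma cvgn_dist (u : nat -> V) (l : V) (e : R) : u n @[n --> \oo] --> l -> 0 < e ->
  exists N, forall n, (N <= n)%N -> `|u n - l| <= e.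
Proof.
move=> /cvgr_dist_le ul e0; have [N _ uN] := ul _ e0.
by exists N => n Nn; rewrite distrC; exact: uN.
Qed.

End nonexpansive_maps.

Lemma cauchy_seq_cvg (R : realType) (V : completeNormedModType R) (u : nat -> V) :
  (forall e, 0 < e -> exists N, forall m n, (N <= m)%N -> (N <= n)%N ->
     `|u m - u n| <= e) -> cvgn u.
Proof.
move=> uC; apply/cauchy_cvgP/cauchy_exP => e e0.
have [N uN] := uC _ (divr_gt0 e0 (ltr0n R 2)).
exists (u N); exists N => // n /= Nn; rewrite -ball_normE /=.
by apply: le_lt_trans (uN _ _ (leqnn N) Nn) _; rewrite ltr_pdivrMr// ltr_pMr// ltr1n.
Qed.

Section euler_semigroup.
Variables (R : realType) (V : completeNormedModType R) (T : {linear V -> V}).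

Definition euler_step (k : R) (x : V) : V := x + k *: T x.

Definition euler (n : nat) (t : R) : V -> V := iter n (euler_step (t / n%:R)).

(** This is exp(tT) x. The index [n.+1] avoids a division by zero. The limit will come from
    contractivity of small steps, so no norm of [T] enters. *)
Definition esg (t : R) (x : V) : V := limn (fun n => euler n.+1 t x).

Lemma euler_stepC k l x : euler_step k (euler_step l x) = euler_step l (euler_step k x).
Proof.
rewrite /euler_step !(linearD T) !(linearZ_LR T) !scalerDr !scalerA -!addrA.
by congr (_ + _); rewrite addrCA (mulrC k l).
Qed.

Lemma generator_euler_stepC k x : T (euler_step k x) = euler_step k (T x).
Proof. by rewrite /euler_step (linearD T) (linearZ_LR T). Qed.

Variable h : R.
Hypothesis h_gt0 : 0 < h.
Hypothesis contr : forall k x, 0 <= k -> k <= h -> `|euler_step k x| <= `|x|.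

Lemma euler_step_nonexpansive k : 0 <= k -> k <= h -> nonexpansive (euler_step k).
Proof.
move=> k0 kh x y; suff <- : euler_step k (x - y) = euler_step k x - euler_step k y
  by exact: contr.
by rewrite /euler_step linearB scalerBr opprD addrACA.
Qed.

(** Telescoping against the identity: one Euler step displaces [x] by [k *: T x]. *)
Lemma iter_euler_dist m k x : 0 <= k -> k <= h ->
  `|iter m (euler_step k) x - x| <= m%:R * k * `|T x|.
Proof.
move=> k0 kh; have E1 := euler_step_nonexpansive k0 kh.
apply: le_trans (_ : _ <= m%:R * `|euler_step k x - x|) _; last first.
  by rewrite /euler_step addrAC subrr add0r normrZ ger0_norm// mulrA.
have -> : iter m (euler_step k) x - x = iter m (euler_step k) x - iter m id x.
  by congr (_ - _); elim: m => //= m <-.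
exact: iter_nonexpansive_dist.
Qed.

(** Second-order Taylor bound. Step [m] adds the error [k *: (T y - T x)]; as [T] commutes with the
    steps, [T y] is the iterate of [T x], so the error is at most [m k^2 |T (T x)|], and
    [(m k)^2 + m k^2 <= ((m + 1) k)^2]. *)
Lemma iter_euler_approx m k x : 0 <= k -> k <= h ->
  `|iter m (euler_step k) x - x - (m%:R * k) *: T x| <= (m%:R * k) ^+ 2 * `|T (T x)|.
Proof.
move=> k0 kh; elim: m => [|m IH] /=.
  by rewrite mul0r scale0r !subrr normr0 mulr_ge0// sqr_ge0.
set y := iter m _ x in IH *.
have -> : euler_step k y - x - (m.+1%:R * k) *: T x =
          (y - x - (m%:R * k) *: T x) + k *: (T y - T x).
  rewrite /euler_step -natr1 mulrDl mul1r scalerDl scalerBr !opprD !addrA.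
  by rewrite -!addrA; congr (_ + _); rewrite addrCA; congr (_ + _); rewrite addrCA.
apply: le_trans (ler_normD _ _) _; apply: le_trans (lerD IH (lexx _)) _.
rewrite normrZ ger0_norm//.
have -> : T y = iter m (euler_step k) (T x).
  by rewrite /y (iter_commute _ (f := T))// => z; exact: generator_euler_stepC.
apply: le_trans (lerD (lexx _) (ler_wpM2l k0 (iter_euler_dist m (T x) k0 kh))) _.
rewrite !mulrA -mulrDl ler_wpM2r// -natr1; have := ler0n R m; nra.
Qed.

Lemma euler_ltP (t : R) : exists N, forall n, (N < n)%N -> t / n%:R <= h.
Proof.
exists (Num.truncn (t / h)) => n tn; have n0 : (0 < n)%N by case: n tn.
by rewrite ler_pdivrMr ?ltr0n// mulrC -ler_pdivrMr// ltW// (lt_le_trans (truncnS_gt _))// ler_nat.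
Qed.

(** Each of the [n.+1] steps of size [k] is refined into [m.+1] steps of size [l], at a cost of
    [k^2 |T (T x)|] per step. *)
Lemma euler_mul_dist n m t x : 0 <= t -> t / n.+1%:R <= h ->
  `|euler n.+1 t x - euler (n.+1 * m.+1) t x| <= t ^+ 2 / n.+1%:R * `|T (T x)|.
Proof.
move=> t0 tnh; set k := t / n.+1%:R; set l := k / m.+1%:R.
have k0 : 0 <= k by rewrite divr_ge0.
have l0 : 0 <= l by rewrite divr_ge0.
have ml : m.+1%:R * l = k by rewrite mulrC divfK// pnatr_eq0.
have lh : l <= h by rewrite (le_trans _ tnh)// ler_pdivrMr// ler_peMr// ler1n.
rewrite /euler natrM invfM mulrA -/k -/l iterM.
have El := euler_step_nonexpansive l0 lh.
apply: le_trans (iter_nonexpansive_dist _ (euler_step_nonexpansive k0 tnh) _ _ _) _.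
- exact: nonexpansive_iter.
- by apply: iter_commute => y; exact: euler_stepC.
apply: le_trans (_ : _ <= n.+1%:R * (k ^+ 2 * `|T (T x)|)) _.
  rewrite ler_wpM2l//.
  have := iter_euler_approx m.+1 x l0 lh; rewrite ml; apply: le_trans.
  by rewrite distrC {1}/euler_step opprD addrA.
rewrite mulrA ler_wpM2r// /k expr_div_n mulrCA ler_wpM2l ?sqr_ge0//.
by rewrite expr2 invfM mulrA divff ?mul1r ?pnatr_eq0.
Qed.

Lemma esg_cvg t x : 0 <= t -> euler n.+1 t x @[n --> \oo] --> esg t x.
Proof.
move=> t0; apply: cauchy_seq_cvg => e e0.
pose c := t ^+ 2 * `|T (T x)|.
have c0 : 0 <= c by rewrite mulr_ge0// sqr_ge0.
have [N Nh] := euler_ltP t.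
pose M := maxn N (Num.truncn (c / (e / 2))).
have Mc n : (M <= n)%N -> c / n.+1%:R <= e / 2 /\ t / n.+1%:R <= h.
  rewrite geq_max => /andP[Nn cn]; split; last exact: Nh.
  rewrite ler_pdivrMr// mulrC -ler_pdivrMr ?divr_gt0//.
  by rewrite ltW// (lt_le_trans (truncnS_gt _))// ler_nat.
exists M => m n /Mc[cm mh] /Mc[cn nh].
(* Both products are compared with their common refinement. *)
apply: le_trans (ler_distD (euler (m.+1 * n.+1) t x) _ _) _.
rewrite [leRHS](splitr e) lerD//.
  by apply: le_trans (euler_mul_dist _ _ t0 mh) _; rewrite mulrAC.
rewrite distrC mulnC.
by apply: le_trans (euler_mul_dist _ _ t0 nh) _; rewrite mulrAC.
Qed.

Lemma euler_near t : 0 <= t ->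
  \forall n \near \oo, 0 <= t / n.+1%:R /\ t / n.+1%:R <= h.
Proof.
move=> t0; have [N Nh] := euler_ltP t.
by exists N => // n /= Nn; split; [rewrite divr_ge0|exact: Nh].
Qed.

Lemma esg_nonexpansive t : 0 <= t -> nonexpansive (esg t).
Proof.
move=> t0 x y.
have E : euler n.+1 t x - euler n.+1 t y @[n --> \oo] --> esg t x - esg t y.
  by apply: cvgB; exact: esg_cvg.
rewrite -[leLHS](cvg_lim _ (cvg_norm E))//; apply: limr_le.
  by apply/cvg_ex; eexists; exact: cvg_norm E.
near=> n; have [k0 kh] : 0 <= t / n.+1%:R /\ t / n.+1%:R <= h.
  by near: n; exact: euler_near.
exact: (nonexpansive_iter n.+1 (euler_step_nonexpansive k0 kh)).
Unshelve. all: by end_near. Qed.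

Lemma euler_linear n t : linear (euler n t).
Proof.
move=> c x y; rewrite /euler; move: (t / _) => k; elim: n => //= n ->.
rewrite /euler_step (linearD T) (linearZ_LR T) !scalerDr !scalerA (mulrC c).
by rewrite addrACA.
Qed.

Lemma esg_linear t : 0 <= t -> linear (esg t).
Proof.
move=> t0 c x y.
have E : euler n.+1 t (c *: x + y) @[n --> \oo] --> c *: esg t x + esg t y.
  rewrite (_ : (fun n => _) = (fun n => c *: euler n.+1 t x + euler n.+1 t y)).
    by apply: cvgD; [apply: cvgZr|]; exact: esg_cvg.
  by apply/funext => n; exact: euler_linear.
exact: cvg_unique (esg_cvg _) E.
Qed.

(** The Euler bound depends on the number and size of the steps only through their product [t],
    hence passes to the limit. It shows that the orbit has derivative [T x] at 0. *)
Lemma esg_approx t x : 0 <= t ->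
  `|esg t x - x - t *: T x| <= t ^+ 2 * `|T (T x)|.
Proof.
move=> t0.
rewrite -addrA -opprD; apply: (le_dist_lim _ (@esg_cvg t x t0) (cvg_cst _)).
near=> n; have [k0 kh] : 0 <= t / n.+1%:R /\ t / n.+1%:R <= h.
  by near: n; exact: euler_near.
have := iter_euler_approx n.+1 x k0 kh.
by rewrite (mulrC n.+1%:R) divfK ?pnatr_eq0// opprD addrA.
Unshelve. all: by end_near. Qed.

Lemma esg0 x : esg 0 x = x.
Proof.
apply/eqP; rewrite -subr_eq0 -normr_le0.
by have := esg_approx x (lexx 0); rewrite scale0r subr0 expr0n mul0r.
Qed.

(** Steps of sizes [s/n] and [t/n] compose to one of size [(s + t)/n] up to [(s t / n^2) T (T x)];
    over [n] commuting steps this is of order [1/n]. *)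
Lemma esgD s t x : 0 <= s -> 0 <= t -> esg (s + t) x = esg s (esg t x).
Proof.
move=> s0 t0.
have st0 : 0 <= s + t by exact: addr_ge0.
apply/eqP; rewrite -subr_eq0 -normr_le0.
(* In [B], the first term is the regrouping error; the other two replace the inner and the outer
   limit by Euler products. *)
apply: (le_dist_lim _ (@esg_cvg (s + t) x st0)
  (B := fun n => s * t * `|T (T x)| / n.+1%:R + `|euler n.+1 t x - esg t x|
                 + `|euler n.+1 s (esg t x) - esg s (esg t x)|)).
  rewrite -(addr0 (0 : R)) -[X in X + _]addr0; apply: cvgD; first apply: cvgD.
  - rewrite -(mulr0 (s * t * `|T (T x)|)); apply: cvgMr.
    exact: cvg_harmonic.
  - apply/norm_cvg0P; apply/subr_cvg0; exact: esg_cvg.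
  - apply/norm_cvg0P; apply/subr_cvg0; exact: esg_cvg.
near=> n.
have [k0 kh] : 0 <= s / n.+1%:R /\ s / n.+1%:R <= h by near: n; exact: euler_near.
have [l0 lh] : 0 <= t / n.+1%:R /\ t / n.+1%:R <= h by near: n; exact: euler_near.
have [m0 mh] : 0 <= (s + t) / n.+1%:R /\ (s + t) / n.+1%:R <= h.
  by near: n; exact: euler_near.
set k := s / _ in k0 kh; set l := t / _ in l0 lh.
have Ek := euler_step_nonexpansive k0 kh.
have El := euler_step_nonexpansive l0 lh.
have Em := euler_step_nonexpansive m0 mh.
apply: le_trans (ler_distD (euler n.+1 s (esg t x)) _ _) _; rewrite lerD//.
apply: le_trans (ler_distD (euler n.+1 s (euler n.+1 t x)) _ _) _; rewrite lerD//; last first.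
  exact: (nonexpansive_iter n.+1 Ek).
have -> : euler n.+1 s (euler n.+1 t x) = iter n.+1 (euler_step k \o euler_step l) x.
  rewrite /euler -/k -/l; elim: n.+1 => //= j <-.
  by congr (euler_step k _); apply/esym/iter_commute => z; exact: euler_stepC.
apply: le_trans (iter_nonexpansive_dist _ Em _ _ _) _.
- by move=> y z /=; apply: le_trans (Ek _ _) (El _ _).
- by move=> y /=; rewrite euler_stepC (euler_stepC _ l).
have -> : euler_step ((s + t) / n.+1%:R) x - (euler_step k \o euler_step l) x
          = - ((k * l) *: T (T x)).
  rewrite /= /euler_step mulrDl -/k -/l (linearD T) (linearZ_LR T).
  by rewrite scalerDr scalerA scalerDl (addrC (k *: _)) !addrA opprD addrA subrr sub0r.
rewrite normrN normrZ ger0_norm ?mulr_ge0// /k /l.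
rewrite le_eqVlt; apply/orP; left; apply/eqP; field.
by rewrite nat1r pnatr_eq0.
Unshelve. all: by end_near. Qed.

(** Serves to transfer positivity, with [C] the cone of nonnegative sequences. *)
Lemma esg_closed (C : set V) t x : 0 <= t -> closed C ->
  (forall k y, 0 <= k -> k <= h -> C y -> C (euler_step k y)) ->
  C x -> C (esg t x).
Proof.
move=> t0 clC CE Cx; apply: (closed_cvg C clC _ _ (esg_cvg (x := x) t0)).
near=> n; have [k0 kh] : 0 <= t / n.+1%:R /\ t / n.+1%:R <= h.
  by near: n; exact: euler_near.
by rewrite /euler; move: (t / _) k0 kh => k k0 kh; elim: n.+1 => //= j; exact: CE.
Unshelve. all: by end_near. Qed.

End euler_semigroup.

(** * Semigroups generated by a consistent sequence of bounded operators *)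

Lemma closure_prodP (R : realType) (V : normedModType R) (G : set (V * V)) x y :
  closure G (x, y) <-> forall e, 0 < e ->
    exists x' y', [/\ G (x', y'), `|x - x'| <= e & `|y - y'| <= e].
Proof.
split=> [clG e e0|clG B].
  have /clG[[x' y'] [Gxy [/= xx' yy']]] : nbhs (x, y) (ball (x, y) e).
    exact: nbhsx_ballx.
  exists x', y'; split => //; apply: ltW.
    by move: xx'; rewrite -ball_normE.
  by move: yy'; rewrite -ball_normE.
move=> /nbhs_ballP[e /= e0 eB].
have [x' [y' [Gxy xx' yy']]] := clG _ (divr_gt0 e0 (ltr0n R 2)).
exists (x', y'); split => //; apply: eB.
have e2 : e / 2 < e by rewrite ltr_pdivrMr// ltr_pMr// ltr1n.
by split; rewrite /= -ball_normE/=; [apply: le_lt_trans xx' e2|apply: le_lt_trans yy' e2].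
Qed.

Section filtered_semigroup.
Variables (R : realType) (V : completeNormedModType R).
Variables (T : nat -> {linear V -> V}) (F : nat -> set V).

Hypothesis contr : forall N, exists2 h, 0 < h &
  forall k x, 0 <= k -> k <= h -> `|euler_step (T N) k x| <= `|x|.
Hypothesis F_lin : forall N c x y, F N x -> F N y -> F N (c *: x + y).
Hypothesis F_inv : forall N x, F N x -> F N (T N x).
Hypothesis F_local : forall N M x, (N <= M)%N -> F N x -> T M x = T N x.
Hypothesis F_dense : forall x e, 0 < e -> exists N y, F N y /\ `|x - y| <= e.
Hypothesis F_range : forall N y, F N y -> exists2 x, F N x & x - T N x = y.

(** On [F N] the sequence is constant from index [N] on; elsewhere it converges by density. *)
Definition lsg (t : R) (x : V) : V := limn (fun N => esg (T N) t x).

Definition core_graph : set (V * V) :=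
  [set xy | exists2 N, F N xy.1 & xy.2 = T N xy.1].

Let tg_nonexpansive N t : 0 <= t -> nonexpansive (esg (T N) t).
Proof. by move=> t0; have [h h0 hc] := contr N; exact: esg_nonexpansive h0 hc _ t0. Qed.

Lemma esg_local N M t x : (N <= M)%N -> F N x -> esg (T M) t x = esg (T N) t x.
Proof.
move=> NM Nx; rewrite /esg; congr (limn _); apply/funext => n; rewrite /euler.
move: (t / _) => k.
(* Membership in [F N] is carried along the induction, since [T M] and [T N] agree only there. *)
suff : iter n.+1 (euler_step (T M) k) x = iter n.+1 (euler_step (T N) k) x /\
  F N (iter n.+1 (euler_step (T N) k) x) by case.
elim: n.+1 => //= m [-> Fm]; split.
  by rewrite /euler_step (F_local NM).
by rewrite /euler_step addrC; apply: F_lin => //; exact: F_inv.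
Qed.

(** All [esg (T N) t] are nonexpansive and the sequence is stationary on the dense union of the
    [F N], so it is Cauchy at every [x]. *)
Lemma lsg_cvg t x : 0 <= t -> esg (T N) t x @[N --> \oo] --> lsg t x.
Proof.
move=> t0; apply: cauchy_seq_cvg => e e0.
have [N [y [Ny xy]]] := F_dense x (divr_gt0 e0 (ltr0n R 2)).
exists N => m n Nm Nn.
apply: le_trans (ler_distD (esg (T m) t y) _ _) _; rewrite [leRHS](splitr e) lerD//.
  exact: le_trans (tg_nonexpansive _ t0 _ _) xy.
rewrite (esg_local _ Nm Ny) -(esg_local _ Nn Ny) distrC.
exact: le_trans (tg_nonexpansive _ t0 _ _) xy.
Qed.

Lemma lsg_core N t x : 0 <= t -> F N x -> lsg t x = esg (T N) t x.
Proof.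
move=> t0 Nx; apply: cvg_lim => //; apply: cvg_near_cst.
by exists N => // M NM; exact: esg_local.
Qed.

Lemma lsg_nonexpansive t : 0 <= t -> nonexpansive (lsg t).
Proof.
move=> t0 x y.
apply: (ler_cvg_to (cvg_norm (cvgB (@lsg_cvg t x t0) (@lsg_cvg t y t0))) (cvg_cst _)).
by near=> N; exact: tg_nonexpansive.
Unshelve. all: by end_near. Qed.

Lemma lsg_linear t : 0 <= t -> linear (lsg t).
Proof.
move=> t0 c x y.
have E : esg (T N) t (c *: x + y) @[N --> \oo] --> c *: lsg t x + lsg t y.
  rewrite (_ : (fun N => _) = (fun N => c *: esg (T N) t x + esg (T N) t y)).
    by apply: cvgD; [apply: cvgZr|]; exact: lsg_cvg.
  by apply/funext => N; have [h h0 hc] := contr N; exact: esg_linear h0 hc _ t0 _ _ _.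
exact: cvg_unique (lsg_cvg _) E.
Qed.

Lemma lsg_contr t x : 0 <= t -> `|lsg t x| <= `|x|.
Proof.
move=> t0; have L := lsg_linear t0.
have S0 : lsg t 0 = 0 by have := L (-1) 0 0; rewrite scaler0 addr0 scaleN1r addNr.
by have := lsg_nonexpansive t0 x 0; rewrite S0 !subr0.
Qed.

Lemma lsg0 x : lsg 0 x = x.
Proof.
apply: cvg_lim => //; apply: cvg_near_cst; apply: nearW => N.
by have [h h0 hc] := contr N; exact: esg0 h0 hc _.
Qed.

Lemma lsgD s t x : 0 <= s -> 0 <= t -> lsg (s + t) x = lsg s (lsg t x).
Proof.
move=> s0 t0; have st0 : 0 <= s + t by exact: addr_ge0.
apply/eqP; rewrite -subr_eq0 -normr_le0.
apply: (le_dist_lim _ (@lsg_cvg (s + t) x st0)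
  (B := fun N => `|esg (T N) t x - lsg t x|
                 + `|esg (T N) s (lsg t x) - lsg s (lsg t x)|)).
  by rewrite -(addr0 (0 : R)); apply: cvgD; apply/norm_cvg0P/subr_cvg0; exact: lsg_cvg.
near=> N; have [h h0 hc] := contr N.
rewrite (esgD h0 hc)//.
apply: le_trans (ler_distD (esg (T N) s (lsg t x)) _ _) _; rewrite lerD//.
exact: tg_nonexpansive.
Unshelve. all: by end_near. Qed.

Lemma lsg_closed (C : set V) t x : 0 <= t -> closed C ->
  (forall N, exists2 h, 0 < h &
     forall k y, 0 <= k -> k <= h -> C y -> C (euler_step (T N) k y)) ->
  C x -> C (lsg t x).
Proof.
move=> t0 clC CE Cx; apply: (closed_cvg C clC _ _ (lsg_cvg (x := x) t0)).
near=> N; have [h h0 hc] := contr N; have [h' h'0 hC] := CE N.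
apply: (@esg_closed _ _ (T N) (Num.min h h')) => //.
- by rewrite lt_min h0.
- by move=> k y k0; rewrite le_min => /andP[kh _]; exact: hc.
- by move=> k y k0; rewrite le_min => /andP[_ kh]; exact: hC.
Unshelve. all: by end_near. Qed.

Lemma lsg_approx N t x : 0 <= t -> F N x ->
  `|lsg t x - x - t *: T N x| <= t ^+ 2 * `|T N (T N x)|.
Proof.
move=> t0 Nx; rewrite (lsg_core t0 Nx); have [h h0 hc] := contr N.
exact: esg_approx h0 hc _ _ t0.
Qed.

Lemma lsg_small x e : 0 < e ->
  exists2 s, 0 < s & forall t, 0 <= t -> t <= s -> `|lsg t x - x| <= e.
Proof.
move=> e0; have [N [y [Ny xy]]] := F_dense x (divr_gt0 e0 (ltr0n R 4)).
pose c := `|T N y| + `|T N (T N y)|.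
have c0 : 0 <= c by rewrite addr_ge0.
(* The bound 1 reduces [t ^+ 2] to [t]; the other makes [t * (c + 1)] at most [e / 2], where the
   added 1 covers [c = 0]. The remaining [e / 2] pays for replacing [x] by [y] twice. *)
exists (Num.min 1 (e / 2 / (c + 1))).
  by rewrite lt_min ltr01 !divr_gt0// ltr_pwDr.
move=> t t0; rewrite le_min => /andP[t1 tc].
have tc2 : t * (c + 1) <= e / 2 by rewrite -ler_pdivlMr// ltr_pwDr.
have yy : `|lsg t y - y| <= e / 2.
  rewrite -(subrK (t *: T N y) (lsg t y - y)).
  apply: le_trans (ler_normD _ _) _.
  apply: le_trans (lerD (lsg_approx t0 Ny) (lexx _)) _.
  rewrite normrZ ger0_norm// (le_trans _ tc2)// /c.
  have := normr_ge0 (T N y); have := normr_ge0 (T N (T N y)).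
  move: `|T N (T N y)| `|T N y| => u v u0 v0.
  rewrite expr2 -mulrA -mulrDr ler_wpM2l//.
  by have : t * u <= u by [rewrite ler_piMl]; lra.
have -> : lsg t x - x = (lsg t x - lsg t y) + ((lsg t y - y) + (y - x)).
  by rewrite !addrA !subrK.
apply: le_trans (ler_normD _ _) _.
have := lsg_nonexpansive t0 x y; have := ler_normD (lsg t y - y) (y - x).
by rewrite (distrC y x); lra.
Qed.

Lemma lsg_C0 : C0_semigroup lsg.
Proof.
split.
- exact: lsg_linear.
- by move=> t t0; apply: nonexpansive_continuous; exact: lsg_nonexpansive.
- exact: lsg0.
- exact: lsgD.
move=> x; apply/cvgrPdist_le => e e0; have [s s0 sx] := lsg_small x e0.
near=> t; rewrite distrC; apply: sx => //.
by near: t; exact: nbhs_right_le.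
Unshelve. all: by end_near. Qed.

(** * Identification of the generator of the limit semigroup *)

(* Split [[0, t]] into [n] equal steps and use the semigroup law. *)
Lemma core_increment N t x e : 0 <= t -> F N x ->
  (forall s, 0 <= s -> s <= t -> `|lsg s (T N x) - T N x| <= e) ->
  `|lsg t x - x - t *: T N x| <= t * e.
Proof.
move=> t0 Nx se; set y := T N x in se *.
set c := `|T N y|.
have step n m : (m <= n.+1)%N ->
    `|lsg (m%:R * (t / n.+1%:R)) x - x - (m%:R * (t / n.+1%:R)) *: y| <=
    m%:R * ((t / n.+1%:R) ^+ 2 * c + t / n.+1%:R * e).
  set k := t / n.+1%:R; have k0 : 0 <= k by rewrite divr_ge0.
  have nk : n.+1%:R * k = t by rewrite mulrC divfK ?pnatr_eq0.
  elim: m => [|m IH] mn; first by rewrite !mul0r scale0r subr0 lsg0 subrr normr0.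
  have mk0 : 0 <= m%:R * k by rewrite mulr_ge0.
  have mkt : m%:R * k <= t by rewrite -nk ler_wpM2r// ler_nat ltnW.
  (* The first bracket is the second-order error of one step, carried by a contraction; the last is
     the deviation of the orbit of [y] from [y], bounded by [e]. *)
  have -> : lsg (m.+1%:R * k) x - x - (m.+1%:R * k) *: y =
      (lsg (m%:R * k) (lsg k x) - lsg (m%:R * k) (k *: y + x)) +
      (lsg (m%:R * k) x - x - (m%:R * k) *: y + k *: (lsg (m%:R * k) y - y)).
    rewrite lsg_linear// -lsgD// -natr1 mulrDl mul1r scalerDl scalerBr !opprD !addrA.
    by rewrite subrK !(addrAC _ _ (k *: lsg _ y)) addrK.
  apply: le_trans (ler_normD _ _) _.
  apply: le_trans (lerD (lexx _) (ler_normD _ _)) _.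
  rewrite normrZ (ger0_norm k0).
  have := lsg_nonexpansive mk0 (lsg k x) (k *: y + x).
  have := lsg_approx k0 Nx; rewrite -/y -/c -addrA -opprD (addrC x).
  have := IH (ltnW mn); have := ler_wpM2l k0 (se _ mk0 mkt).
  by rewrite -natr1; lra.
(* As [n] grows, the contribution of [c] vanishes and only [t * e] remains. *)
apply: (@ler_cvg_to nat \oo _ R (fun=> `|lsg t x - x - t *: y|)
  (fun n => t ^+ 2 * c / n.+1%:R + t * e)); first exact: cvg_cst.
  rewrite -[X in _ --> X]add0r; apply: cvgD; last exact: cvg_cst.
  by rewrite -(mulr0 (t ^+ 2 * c)); apply: cvgMr; exact: cvg_harmonic.
near=> n; have := step n n.+1 (leqnn _).
have -> : n.+1%:R * (t / n.+1%:R) = t by rewrite mulrC divfK ?pnatr_eq0.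
move=> /le_trans; apply; rewrite le_eqVlt; apply/orP; left; apply/eqP; field.
by rewrite nat1r pnatr_eq0.
Unshelve. all: by end_near. Qed.

(** The bound of [core_increment] contains no second power of [T N], which would be uncontrolled in
    the graph norm; hence it extends to the closure. *)
Lemma closure_increment x y t e : 0 <= t -> closure core_graph (x, y) ->
  (forall s, 0 <= s -> s <= t -> `|lsg s y - y| <= e) ->
  `|lsg t x - x - t *: y| <= t * e.
Proof.
move=> t0 /closure_prodP xy se; apply/ler_addgt0Pr => u u0.
(* The errors add up to [v] for each of [x'] and its orbit, [2 * t * v] from the core estimate and
   [t * v] from [T N x' - y]. *)
pose v := u / (2 + 3 * t).
have w0 : 0 < 2 + 3 * t by lra.
have v0 : 0 < v by exact: divr_gt0.
have [x' [y' [[N /= Nx' ->] xx' yy']]] := xy _ v0.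
have I : `|lsg t x' - x' - t *: T N x'| <= t * (e + 2 * v).
  apply: core_increment => // s s0 st.
  have := lsg_nonexpansive s0 (T N x') y; have := se s s0 st.
  have -> : lsg s (T N x') - T N x' =
      (lsg s (T N x') - lsg s y) + (lsg s y - y) + (y - T N x').
    by rewrite !addrA !subrK.
  move=> h1 h2; apply: le_trans (ler_normD _ _) _.
  apply: le_trans (lerD (ler_normD _ _) (lexx _)) _.
  by rewrite (distrC (T N x')) in h2; lra.
have -> : lsg t x - x - t *: y = (lsg t x - lsg t x') +
    (lsg t x' - x' - t *: T N x') + ((x' - x) + t *: (T N x' - y)).
  rewrite scalerBr !addrA subrK; rewrite (addrAC _ _ x') subrK.
  by rewrite !(addrAC _ _ (t *: T N x')) addrK.
apply: le_trans (ler_normD _ _) _.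
apply: le_trans (lerD (ler_normD _ _) (ler_normD _ _)) _.
rewrite normrZ (ger0_norm t0) (distrC x') (distrC (T N x')).
have := lsg_nonexpansive t0 x x'; have := ler_wpM2l t0 yy'.
have : v * (2 + 3 * t) = u by rewrite /v divfK// gt_eqF.
by lra.
Qed.

Lemma closure_core_generator : closure core_graph `<=` generator lsg.
Proof.
move=> [x y] xy; apply/cvgrPdist_le => e e0.
have [s s0 sy] := lsg_small y e0.
near=> t.
have t0 : 0 < t by near: t; exact: nbhs_right_gt.
have ts : t <= s by near: t; exact: nbhs_right_le.
have I : `|lsg t x - x - t *: y| <= t * e.
  by apply: closure_increment (ltW t0) xy _ => u u0 ut; apply: sy => //; exact: le_trans ts.
rewrite /= distrC -{1}(scale1r y) -(mulVf (lt0r_neq0 t0)) -scalerA -scalerBr normrZ.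
by rewrite ger0_norm ?invr_ge0 ?(ltW t0)// mulrC ler_pdivrMr// mulrC.
Unshelve. all: by end_near. Qed.

(** Contractivity gives [(1 + t^-1) |x| - t^-1 |lsg t x| >= |x|]; then [t] tends to 0. *)
Lemma generator_dissipative x y : generator lsg (x, y) -> `|x| <= `|x - y|.
Proof.
rewrite /generator /= => xy.
apply: (ler_cvg_to (cvg_cst _) (cvg_norm (cvgB (cvg_cst x) xy))).
near=> t.
have t0 : 0 < t by near: t; exact: nbhs_right_gt.
change (`|x| <= `|x - t^-1 *: (lsg t x - x)|).
have -> : x - t^-1 *: (lsg t x - x) = (1 + t^-1) *: x - t^-1 *: lsg t x.
  by rewrite scalerBr scalerDl scale1r opprB addrA addrAC.
apply: le_trans (lerB_dist _ _).
have ti : 0 <= t^-1 by rewrite invr_ge0 ltW.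
rewrite !normrZ !ger0_norm ?addr_ge0//.
have := ler_wpM2l ti (lsg_contr x (ltW t0)); lra.
Unshelve. all: by end_near. Qed.

Lemma generator_sub x y x' y' : generator lsg (x, y) -> generator lsg (x', y') ->
  generator lsg (x - x', y - y').
Proof.
rewrite /generator /= => xy xy'.
have E : t^-1 *: (lsg t x - x) - t^-1 *: (lsg t x' - x') @[t --> 0^'+] --> y - y'.
  exact: cvgB.
apply: cvg_trans E; apply: near_eq_cvg; near=> t.
have t0 : 0 <= t by near: t; exact: nbhs_right_ge.
have -> : lsg t (x - x') = lsg t x - lsg t x'.
  by rewrite addrC -scaleN1r lsg_linear// scaleN1r addrC.
by rewrite -scalerBr !opprD !opprK addrACA.
Unshelve. all: by end_near. Qed.

(** Given [(x, y)] in the generator, approximate [x - y] by some [z] in [F N] and solve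
    [x' - T N x' = z]. Dissipativity of the difference bounds [x - x'] by [x - y - z], and
    [y - T N x'] is the difference of these two. *)
Lemma generator_closure_core : generator lsg = closure core_graph.
Proof.
apply/seteqP; split; last exact: closure_core_generator.
move=> [x y] xy; apply/closure_prodP => e e0.
have [N [z [Nz xyz]]] := F_dense (x - y) (divr_gt0 e0 (ltr0n R 2)).
have [x' Nx' x'z] := F_range Nz.
exists x', (T N x').
have zE : x - y - z = x - x' - (y - T N x').
  by rewrite -x'z !opprD !opprK addrACA.
have xx' : `|x - x'| <= e / 2.
  apply: le_trans xyz; rewrite zE.
  apply: generator_dissipative; apply: generator_sub => //.
  by apply: closure_core_generator; apply: subset_closure; exists N.
split; [by exists N| by rewrite (le_trans xx')// ler_pdivrMr// ler_pMr// ler1n|].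
rewrite -(subKr (x - x') (y - T N x')) -zE.
apply: le_trans (ler_normB _ _) _.
by rewrite [leRHS](splitr e) lerD.
Qed.

(** Both second components are the derivative at 0 of the orbit of [x]. *)
Lemma closable_core : closable core_graph.
Proof.
move=> x y z /closure_core_generator xy /closure_core_generator xz.
exact: cvg_unique xy xz.
Qed.

End filtered_semigroup.

(** * The weighted l1 space *)

Section weighted_l1_theory.
Variable R : realType.
Implicit Types (f g : nat -> R) (x y : ellw R).

Definition wpsum N f : R := \sum_(0 <= k < N) k.+1%:R * `|f k|.

Lemma wpsum_homo f M N : (M <= N)%N -> wpsum M f <= wpsum N f.
Proof.
move=> MN; rewrite /wpsum [leRHS](big_cat_nat _ (n := M))//= lerDl.
by apply: sumr_ge0 => i _; rewrite mulr_ge0.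
Qed.

Lemma wnorm_leP f (c : R) :
  (wnorm f <= c%:E)%E <-> forall N, wpsum N f <= c.
Proof.
have w0 i : (0 <= (i.+1%:R * `|f i|)%:E)%E by rewrite lee_fin mulr_ge0.
split=> [fc N|fc].
  rewrite -lee_fin /wpsum -sumEFin; apply: le_trans fc.
  exact: nneseries_lim_ge.
apply: lime_le; first exact: is_cvg_nneseries.
by apply: nearW => N; rewrite sumEFin lee_fin; exact: fc.
Qed.

Lemma wl1P f (c : R) : (wnorm f <= c%:E)%E -> f \in wl1.
Proof. by move=> fc; rewrite inE /=; apply: le_lt_trans fc (ltry _). Qed.

Lemma wnormE x : wnorm x = `|x|%:E.
Proof. by rewrite -ellw_normE. Qed.

Lemma wpsum_le N x : wpsum N x <= `|x|.
Proof.
by have : (wnorm x <= `|x|%:E)%E; [rewrite wnormE|move=> /wnorm_leP].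
Qed.

Lemma ellw_coord_le x k : `|x k| <= `|x|.
Proof.
apply: le_trans (wpsum_le k.+1 x); rewrite /wpsum big_nat_recr//=.
apply: ler_wpDl; first by apply: sumr_ge0 => i _; rewrite mulr_ge0.
by rewrite ler_peMl// ler1n.
Qed.

Lemma ellw_coord_continuous k : continuous (fun x : ellw R => x k).
Proof.
apply: (@nonexpansive_continuous _ _ R^o) => x y.
exact: ellw_coord_le (x - y) k.
Qed.

Lemma wpsum_cvg (T : Type) (F : set_system T) (FF : ProperFilter F)
    (u : T -> nat -> R) f N :
  (forall k, u t k @[t --> F] --> f k) -> wpsum N (u t) @[t --> F] --> wpsum N f.
Proof.
move=> uf; rewrite /wpsum; apply: cvg_big => [|k _].
  exact: add_continuous.
by apply: cvgMr; apply: cvg_norm; exact: uf.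
Qed.

(** Lower semicontinuity of the norm under coordinatewise convergence, as each finite partial sum is
    continuous in the coordinates. *)
Lemma wnorm_fatou (T : topologicalType) (F : set_system T) (FF : ProperFilter F)
    (u : T -> nat -> R) f (c : R) :
  (forall k, u t k @[t --> F] --> f k) ->
  (\forall t \near F, (wnorm (u t) <= c%:E)%E) -> (wnorm f <= c%:E)%E.
Proof.
move=> uf uc; apply/wnorm_leP => N.
apply: (@ler_cvg_to T F FF R (fun t => wpsum N (u t)) (fun=> c)).
- exact: wpsum_cvg.
- exact: cvg_cst.
by apply: filterS uc => t /wnorm_leP.
Qed.

Lemma ellw_complete (F : set_system (ellw R)) :
  ProperFilter F -> cauchy F -> cvg F.
Proof.
move=> FF /cauchyP Fc.
have coord k : exists l : R, y k @[y --> F] --> l.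
  apply/cvg_ex/cauchy_cvgP/cauchy_exP => e e0; have [x xF] := Fc e e0.
  exists (x k); apply: (@filterS _ F _ (ball x e)) xF => y; rewrite -!ball_normE /=.
  by apply: le_lt_trans; exact: ellw_coord_le (x - y) k.
have [l lF] := choice coord.
(* By the Fatou bound, the distance from the centre of a Cauchy ball to the coordinatewise limit [l]
   is at most the radius. *)
have cl e : 0 < e -> exists2 x : ellw R, F (ball x e) & (wnorm (val x - l)%R <= e%:E)%E.
  move=> e0; have [x xF] := Fc e e0; exists x => //.
  apply: (@wnorm_fatou _ F FF (fun y => val x - val y)).
    by move=> k; apply: cvgB; [exact: cvg_cst|exact: lF].
  apply: filterS xF => y; rewrite -ball_normE /= => xy.
  change (wnorm (x - y)%R <= e%:E)%E.
  by rewrite wnormE lee_fin ltW.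
have lX : l \in wl1.
  have [x _ xl] := cl 1 ltr01.
  by rewrite -(subKr (val x) l) rpredB ?(valP x)// (wl1P xl).
apply/cvg_ex; exists (Ellw lX); apply/cvgrPdist_le => e e0.
have [x xF xl] := cl _ (divr_gt0 e0 (ltr0n R 2)).
apply: filterS xF => y; rewrite -ball_normE /= => xy.
apply: le_trans (ler_distD x _ _) _; rewrite [leRHS](splitr e).
apply: lerD; last exact: ltW.
by rewrite distrC -lee_fin -wnormE.
Qed.

HB.instance Definition _ := Uniform_isComplete.Build (ellw R) ellw_complete.

(** * Truncation and finitely supported sequences *)

Definition cutoff N f : nat -> R := fun k => if (k < N)%N then f k else 0.

Lemma wpsum_eq0 N M f : (forall k, (N <= k)%N -> f k = 0) -> wpsum M f <= wpsum N f.
Proof.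
move=> f0; case: (leqP M N) => MN; first exact: wpsum_homo.
rewrite /wpsum (big_cat_nat _ (n := N) (p := M))/= ?(ltnW MN)//.
rewrite [X in _ + X]big_nat_cond [X in _ + X]big1 ?addr0// => i /andP[/andP[Ni _] _].
by rewrite f0// normr0 mulr0.
Qed.

Lemma wnorm_finsupp N f : (forall k, (N <= k)%N -> f k = 0) ->
  wnorm f = (wpsum N f)%:E.
Proof.
move=> f0; apply/eqP; rewrite eq_le; apply/andP; split.
  by apply/wnorm_leP => M; exact: wpsum_eq0.
rewrite /wpsum -sumEFin; apply: nneseries_lim_ge => k _ _.
by rewrite lee_fin mulr_ge0.
Qed.

Lemma finsupp_wl1 N f : (forall k, (N <= k)%N -> f k = 0) -> f \in wl1.
Proof. by move=> f0; rewrite inE /= (wnorm_finsupp f0) ltry. Qed.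

Lemma cutoff_eq0 N f k : (N <= k)%N -> cutoff N f k = 0.
Proof. by rewrite /cutoff ltnNge => ->. Qed.

Lemma cutoff_id N f : (forall k, (N <= k)%N -> f k = 0) -> cutoff N f = f.
Proof. by move=> f0; apply/funext => k; rewrite /cutoff; case: ltnP => // /f0. Qed.

Lemma wpsum_cutoff N f : wpsum N (cutoff N f) = wpsum N f.
Proof. by apply: eq_big_nat => k /andP[_ kN]; rewrite /cutoff kN. Qed.

Definition trunc_ellw N f : ellw R := Ellw (finsupp_wl1 (@cutoff_eq0 N f)).

Lemma norm_trunc N f : `|trunc_ellw N f| = wpsum N f.
Proof.
apply: EFin_inj; rewrite -wnormE (wnorm_finsupp (N := N)) ?wpsum_cutoff//.
exact: cutoff_eq0.
Qed.

(** An l1 norm is additive over disjoint supports. *)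
Lemma norm_split_trunc N x : `|x| = wpsum N x + `|x - trunc_ellw N x|.
Proof.
apply: EFin_inj; rewrite -norm_trunc EFinD -!wnormE /wnorm -nneseriesD; last 2 first.
- by move=> k _ _; rewrite lee_fin mulr_ge0.
- by move=> k _ _; rewrite lee_fin mulr_ge0.
apply: eq_eseriesr => k _; rewrite -EFinD -mulrDr; congr (_ * _)%:E.
have -> : (x - trunc_ellw N x) k = x k - cutoff N x k by [].
rewrite /= /cutoff; case: ltnP => _; first by rewrite subrr normr0 addr0.
by rewrite subr0 normr0 add0r.
Qed.

Lemma trunc_cvg x : trunc_ellw N x @[N --> \oo] --> x.
Proof.
apply/cvgrPdist_le => e e0.
have : exists N, `|x| - e < wpsum N x.
  apply: contrapT => /forallNP h.
  have : (wnorm x <= (`|x| - e)%:E)%E.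
    by apply/wnorm_leP => N; rewrite leNgt; apply/negP; exact: h.
  by rewrite wnormE lee_fin; lra.
move=> [N xN]; exists N => // M /= NM.
have := norm_split_trunc M x.
by have := wpsum_homo x NM; lra.
Qed.

(** * Norm estimates for shifts and for [triangle] *)

Lemma wnorm_leD f g (c c' : R) : (wnorm f <= c%:E)%E -> (wnorm g <= c'%:E)%E ->
  (wnorm (f + g)%R <= (c + c')%:E)%E.
Proof. by move=> fc gc; apply: le_trans (wnormD _ _) _; rewrite EFinD leeD. Qed.

Lemma wnorm_leN f (c : R) : (wnorm f <= c%:E)%E -> (wnorm (- f)%R <= c%:E)%E.
Proof.
by apply: le_trans; apply: le_wnorm => k; rewrite -[(- f) k]/(- f k) normrN.
Qed.

Lemma wnorm_le_behead f (c : R) : (wnorm f <= c%:E)%E ->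
  (wnorm (fun k => f k.+1) <= c%:E)%E.
Proof.
move=> /wnorm_leP fc; apply/wnorm_leP => N; apply: le_trans (fc N.+1).
rewrite /wpsum big_nat_recl//= ler_wpDl ?mulr_ge0//.
by apply: ler_sum => k _; rewrite ler_wpM2r// ler_nat.
Qed.

(** The factor 2 comes from the shift of the weight: [k.+2 <= 2 * k.+1]. *)
Lemma wnorm_le_cons f (c c0 : R) : `|f 0%N| <= c0 ->
  (wnorm (fun k => f k.+1) <= c%:E)%E -> (wnorm f <= (c0 + 2 * c)%:E)%E.
Proof.
move=> f0 /wnorm_leP fc; apply/wnorm_leP => -[|N].
  rewrite /wpsum big_nil addr_ge0 ?(le_trans _ f0)// mulr_ge0//.
  by have := fc 0%N; rewrite /wpsum big_nil.
rewrite /wpsum big_nat_recl//= mul1r lerD//.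
apply: le_trans (ler_wpM2l _ (fc N)) => //.
rewrite /wpsum mulr_sumr; apply: ler_sum => k _; rewrite mulrA ler_wpM2r//.
by rewrite -natrM ler_nat mul2n -addnn addSn ltnS leq_addl.
Qed.

Lemma wnorm_le_tail N f (c : R) : (wnorm f <= c%:E)%E ->
  (wnorm (f - cutoff N f)%R <= c%:E)%E.
Proof.
apply: le_trans; apply: le_wnorm => k.
rewrite -[(f - cutoff N f) k]/(f k - cutoff N f k) /cutoff.
by case: ifP => _; rewrite ?subrr ?normr0// subr0.
Qed.

(* Since [u] vanishes at infinity, [u M] is the sum of its increments beyond [M]. *)
Lemma triangle_tail (u : nat -> R) M (c : R) : u n @[n --> \oo] --> (0 : R) ->
  (wnorm (triangle u - cutoff M.+1 (triangle u))%R <= c%:E)%E ->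
  M.+2%:R * `|u M| <= c.
Proof.
move=> u0 /wnorm_leP; set q := (_ - _)%R => qc.
have qE k : (M <= k)%N -> q k.+1 = u k - u k.+1.
  move=> Mk; rewrite -[q _]/(triangle u k.+1 - cutoff M.+1 (triangle u) k.+1).
  by rewrite /cutoff ltnS ltnNge Mk subr0.
(* Induction over the increments: [q (M + j).+1] carries the weight [(M + j).+2], which is at least
   [M.+2]. *)
have step j : M.+2%:R * `|u M| <= M.+2%:R * `|u (M + j)%N| + wpsum (M + j).+1 q.
  elim: j => [|j IH].
    by rewrite addn0 lerDl sumr_ge0// => i _; rewrite mulr_ge0.
  apply: le_trans IH _; rewrite addnS /wpsum [in leRHS]big_nat_recr//=.
  rewrite [X in _ <= _ + X]addrC addrA lerD2r qE ?leq_addr//.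
  apply: le_trans (_ : _ <= M.+2%:R * `|u (M + j).+1| +
      M.+2%:R * `|u (M + j)%N - u (M + j).+1|) _.
    rewrite -mulrDr ler_wpM2l// addrC.
    by rewrite -[in leLHS](subrK (u (M + j).+1) (u (M + j)%N)) ler_normD.
  by rewrite lerD2l ler_wpM2r// ler_nat !ltnS leq_addr.
apply: (@ler_cvg_to nat \oo _ R (fun=> M.+2%:R * `|u M|)
  (fun j => M.+2%:R * `|u (M + j)%N| + c)); first exact: cvg_cst.
  rewrite -[X in _ --> X]add0r; apply: cvgD; last exact: cvg_cst.
  rewrite -(mulr0 M.+2%:R); apply: cvgMr; apply/norm_cvg0P.
  exact: cvg_comp (cvg_addnl M) u0.
by near=> j; apply: le_trans (step j) _; rewrite lerD2l.
Unshelve. all: by end_near. Qed.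

(** Cutting [u] creates a jump [- u M] at index [M.+1], of weight [M.+2]: exactly the quantity
    bounded by [triangle_tail]. *)
Lemma triangle_tail_norm (u : nat -> R) M (c : R) : u n @[n --> \oo] --> (0 : R) ->
  (wnorm (triangle u - cutoff M.+1 (triangle u))%R <= c%:E)%E ->
  (wnorm (triangle (u - cutoff M.+1 u)%R) <= (c + c)%:E)%E.
Proof.
move=> u0 qc; set q := (_ - _)%R in qc.
have -> : triangle (u - cutoff M.+1 u) = q + (fun k => if k == M.+1 then - u M else 0).
  apply/funext => k.
  rewrite -[RHS]/(triangle u k - cutoff M.+1 (triangle u) k +
                  (if k == M.+1 then - u M else 0)).
  have E j : (u - cutoff M.+1 u) j = u j - cutoff M.+1 u j by [].
  case: k => [|k] /=; rewrite !E /cutoff/= ?ltnS; first by rewrite !subrr addr0.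
  rewrite eqSS; case: (ltngtP k M) => [_|_|->].
  - by rewrite !subrr addr0.
  - by rewrite !subr0 addr0.
  - by rewrite !subr0 subrr sub0r addrAC subrr sub0r.
apply: wnorm_leD => //; rewrite (@wnorm_finsupp M.+2); last first.
  by move=> k Mk; rewrite gtn_eqF.
rewrite lee_fin /wpsum big_nat_recr//= eqxx normrN.
rewrite big_nat_cond big1 ?add0r; first exact: triangle_tail qc.
by move=> k /andP[/andP[_ kM] _]; rewrite ltn_eqF// normr0 mulr0.
Qed.

End weighted_l1_theory.

(** * Finite sections of the decay-fragmentation operator *)

Section finite_sections.
Variables (R : realType) (r d a : nat -> R) (b : nat -> nat -> R).

(** The cutoff drops the inflow by decay from index [N]; the rows [i >= N] are discarded only in
    [finsec]. *)
Definition section_op N (f : nat -> R) (i : nat) : R :=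
  r i.+1 * cutoff N f i.+1 - theta r d a i * f i + \sum_(0 <= j < N) a j * b i j * f j.

Definition finsec N (x : ellw R) : ellw R := trunc_ellw N (section_op N x).

Lemma section_op_linear N c (f g : nat -> R) i :
  section_op N (c *: f + g) i = c * section_op N f i + section_op N g i.
Proof.
have E k : (c *: f + g) k = c * f k + g k by [].
have C k : cutoff N (c *: f + g) k = c * cutoff N f k + cutoff N g k.
  by rewrite /cutoff; case: ifP => // _; rewrite mulr0 addr0.
rewrite /section_op C E.
have -> : \sum_(0 <= j < N) a j * b i j * (c *: f + g) j =
    c * \sum_(0 <= j < N) a j * b i j * f j + \sum_(0 <= j < N) a j * b i j * g j.
  by rewrite mulr_sumr -big_split /=; apply: eq_bigr => j _; rewrite E; ring.
by ring.
Qed.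

Lemma finsecE N x k : finsec N x k = if (k < N)%N then section_op N x k else 0.
Proof. by []. Qed.

Lemma finsec_linear N : linear (finsec N).
Proof.
move=> c x y; apply/val_inj/funext => k.
change (finsec N (c *: x + y) k = c * finsec N x k + finsec N y k).
rewrite !finsecE; case: ifP => _; first exact: section_op_linear.
by rewrite mulr0 addr0.
Qed.

HB.instance Definition _ N :=
  GRing.isLinear.Build R (ellw R) (ellw R) _ (finsec N) (finsec_linear N).

Hypothesis r_gt0 : forall i, 0 < r i.
Hypothesis d_ge0 : forall i, 0 <= d i.
Hypothesis a0 : a 0%N = 0.
Hypothesis a_gt0 : forall i, (0 < i)%N -> 0 < a i.
Hypothesis b_ge0 : forall i j, 0 <= b i j.
Hypothesis b_eq0 : forall i j, (j <= i)%N -> b i j = 0.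
Hypothesis b_mass : forall j, (0 < j)%N ->
  \sum_(0 <= i < j) i.+1%:R * b i j = j.+1%:R.

Let a_ge0 i : 0 <= a i.
Proof. by case: i => [|i]; rewrite ?a0// ltW// a_gt0. Qed.

Let theta_ge0 i : 0 <= theta r d a i.
Proof. by rewrite /theta !addr_ge0// ltW. Qed.

(** Decay lowers the size by one, so after reindexing the weight [i] meets the weight [i.+1]. *)
Lemma decay_sum_le N (f : nat -> R) :
  \sum_(0 <= i < N) i.+1%:R * (r i.+1 * `|cutoff N f i.+1|) <=
  \sum_(0 <= i < N) i.+1%:R * (r i * `|f i|).
Proof.
have -> : \sum_(0 <= i < N) i.+1%:R * (r i * `|f i|) =
    \sum_(0 <= i < N.+1) i.+1%:R * (r i * `|cutoff N f i|).
  rewrite big_nat_recr//= /cutoff ltnn normr0 !mulr0 addr0.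
  by apply: eq_big_nat => i /andP[_ iN]; rewrite iN.
rewrite big_nat_recl//=; apply: ler_wpDl; first by rewrite !mulr_ge0// ltW.
apply: ler_sum => i _; rewrite ler_wpM2r ?ler_nat//.
by rewrite mulr_ge0// ltW.
Qed.

(** After exchanging the sums, [b_mass] says that the fragments of [j] carry its whole mass; index 0
    is covered by [a0]. *)
Lemma frag_sum_le N (f : nat -> R) :
  \sum_(0 <= i < N) i.+1%:R * (\sum_(0 <= j < N) a j * b i j * `|f j|) <=
  \sum_(0 <= j < N) j.+1%:R * (a j * `|f j|).
Proof.
under eq_bigr do rewrite mulr_sumr.
rewrite exchange_big /=; apply: ler_sum_nat => j /andP[_ jN].
have -> : \sum_(0 <= i < N) i.+1%:R * (a j * b i j * `|f j|) =
    (\sum_(0 <= i < j) i.+1%:R * b i j) * (a j * `|f j|).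
  rewrite (big_cat_nat _ (n := j))//=; last exact: ltnW.
  rewrite [X in _ + X]big_nat_cond [X in _ + X]big1 ?addr0; last first.
    by move=> i /andP[/andP[ji _] _]; rewrite b_eq0// mulr0 mul0r mulr0.
  by rewrite mulr_suml; apply: eq_bigr => i _; ring.
by case: (posnP j) => [->|j0]; [rewrite a0 mul0r !mulr0|rewrite b_mass].
Qed.

(** For small [h] the diagonal factor [1 - h theta] is nonnegative. The losses [r] and [a] in
    [theta] pay for the gains by decay and fragmentation, and the loss by [d] is left over. Dropping
    it gives contractivity; keeping it gives [death_le]. *)
Lemma section_step_le N (f : nat -> R) h : 0 <= h ->
  (forall i, (i < N)%N -> h * theta r d a i <= 1) ->
  wpsum N (fun i => f i + h * section_op N f i) +
    h * \sum_(0 <= i < N) i.+1%:R * (d i * `|f i|) <= wpsum N f.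
Proof.
move=> h0 hth.
have pt i : (i < N)%N -> `|f i + h * section_op N f i| <= `|f i| +
    h * (r i.+1 * `|cutoff N f i.+1| - r i * `|f i| - a i * `|f i| - d i * `|f i| +
         \sum_(0 <= j < N) a j * b i j * `|f j|).
  move=> iN.
  have -> : f i + h * section_op N f i = (1 - h * theta r d a i) * f i +
      (h * (r i.+1 * cutoff N f i.+1) + h * \sum_(0 <= j < N) a j * b i j * f j).
    by rewrite /section_op; ring.
  apply: le_trans (ler_normD _ _) _.
  apply: le_trans (lerD (lexx _) (ler_normD _ _)) _.
  have hi : 0 <= 1 - h * theta r d a i by rewrite subr_ge0 hth.
  rewrite !normrM (ger0_norm hi) (ger0_norm h0) (ger0_norm (ltW (r_gt0 _))).
  have : `|\sum_(0 <= j < N) a j * b i j * f j| <=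
         \sum_(0 <= j < N) a j * b i j * `|f j|.
    apply: le_trans (ler_norm_sum _ _ _) _; apply: ler_sum => j _.
    by rewrite normrM ger0_norm// mulr_ge0.
  move=> /(ler_wpM2l h0); rewrite /theta; lra.
have S : wpsum N (fun i => f i + h * section_op N f i) <= wpsum N f +
    h * (\sum_(0 <= i < N) i.+1%:R * (r i.+1 * `|cutoff N f i.+1|)
       - \sum_(0 <= i < N) i.+1%:R * (r i * `|f i|)
       - \sum_(0 <= i < N) i.+1%:R * (a i * `|f i|)
       - \sum_(0 <= i < N) i.+1%:R * (d i * `|f i|)
       + \sum_(0 <= i < N) i.+1%:R * (\sum_(0 <= j < N) a j * b i j * `|f j|)).
  rewrite -!sumrB -big_split /= mulr_sumr /wpsum -big_split /=.
  apply: ler_sum_nat => i /andP[_ iN].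
  by apply: le_trans (ler_wpM2l _ (pt i iN)) _ => //; lra.
have := ler_wpM2l h0 (decay_sum_le N f); have := ler_wpM2l h0 (frag_sum_le N f).
by move: S; lra.
Qed.

(** The sum dominates every rate below [N]; the added 1 keeps the inverse positive for [N = 0]. *)
Definition sec_step N : R := (1 + \sum_(0 <= i < N) theta r d a i)^-1.

Lemma sec_step_gt0 N : 0 < sec_step N.
Proof. by rewrite invr_gt0 ltr_pwDl// sumr_ge0. Qed.

Lemma sec_step_theta N i h : 0 <= h -> h <= sec_step N -> (i < N)%N ->
  h * theta r d a i <= 1.
Proof.
move=> h0 hN iN; have s0 : 0 < 1 + \sum_(0 <= i < N) theta r d a i.
  by rewrite ltr_pwDl// sumr_ge0.
apply: le_trans (_ : _ <= sec_step N * (1 + \sum_(0 <= i < N) theta r d a i)) _.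
  rewrite ler_pM//; apply: ler_wpDl => //.
  rewrite (big_cat_nat _ (n := i))//=; last exact: ltnW.
  apply: ler_wpDl; first by rewrite sumr_ge0.
  by rewrite big_ltn// lerDl sumr_ge0.
by rewrite mulVf// gt_eqF.
Qed.

Lemma euler_step_finsecE N h (x : ellw R) k : euler_step (finsec N) h x k =
  if (k < N)%N then x k + h * section_op N x k else x k.
Proof.
change (x k + h * finsec N x k = if (k < N)%N then x k + h * section_op N x k else x k).
by rewrite finsecE; case: ifP => // _; rewrite mulr0 addr0.
Qed.

(** The step acts on the part below [N] and fixes the tail, and the norms of the two parts add
    up. *)
Lemma finsec_contr N h (x : ellw R) : 0 <= h -> h <= sec_step N ->
  `|euler_step (finsec N) h x| <= `|x|.
Proof.
move=> h0 hN; rewrite (norm_split_trunc N x).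
have -> : euler_step (finsec N) h x =
    trunc_ellw N (fun i => x i + h * section_op N x i) + (x - trunc_ellw N x).
  apply/val_inj/funext => k; rewrite -[LHS]/(euler_step (finsec N) h x k).
  rewrite euler_step_finsecE.
  change ((if (k < N)%N then x k + h * section_op N x k else x k) =
    cutoff N (fun i => x i + h * section_op N x i) k + (x k - cutoff N x k)).
  by rewrite /cutoff; case: ifP => _; rewrite ?subrr ?addr0// add0r subr0.
apply: le_trans (ler_normD _ _) _; rewrite lerD2r norm_trunc.
have := section_step_le x h0 (fun i => sec_step_theta h0 hN).
apply: le_trans; rewrite lerDl mulr_ge0// sumr_ge0// => i _.
by rewrite !mulr_ge0.
Qed.

Lemma finsec_nonneg N h (x : ellw R) : 0 <= h -> h <= sec_step N ->
  (forall k, 0 <= x k) -> forall k, 0 <= euler_step (finsec N) h x k.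
Proof.
move=> h0 hN x0 k; rewrite euler_step_finsecE; case: ifP => // kN.
have -> : x k + h * section_op N x k = (1 - h * theta r d a k) * x k +
      h * (r k.+1 * cutoff N x k.+1 + \sum_(0 <= j < N) a j * b k j * x j).
  by rewrite /section_op; ring.
rewrite addr_ge0// mulr_ge0//; first by rewrite subr_ge0 (sec_step_theta h0 hN).
rewrite addr_ge0//; last by rewrite sumr_ge0// => j _; rewrite !mulr_ge0.
by rewrite mulr_ge0 ?(ltW (r_gt0 _))// /cutoff; case: ifP.
Qed.

(** Combine [section_step_le] with [|f| <= |f + h T f| + h |T f|] and divide by [h]. *)
Lemma death_le N (f : nat -> R) :
  \sum_(0 <= i < N) i.+1%:R * (d i * `|f i|) <= wpsum N (section_op N f).
Proof.
set h := sec_step N; have h0 : 0 < h := sec_step_gt0 N.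
rewrite -(ler_pM2l h0).
have := section_step_le f (ltW h0) (fun i => sec_step_theta (ltW h0) (lexx h)).
suff : wpsum N f <= wpsum N (fun i => f i + h * section_op N f i) +
    h * wpsum N (section_op N f) by lra.
rewrite /wpsum mulr_sumr -big_split /=; apply: ler_sum => i _.
rewrite mulrCA -mulrDr ler_wpM2l//.
have := ler_normB (f i + h * section_op N f i) (h * section_op N f i).
by rewrite addrK normrM (ger0_norm (ltW h0)).
Qed.

(** * The filtration by finitely supported sequences *)

Definition supp_below N : set (ellw R) := [set x | forall k, (N <= k)%N -> x k = 0].

Lemma supp_lin N c x y : supp_below N x -> supp_below N y -> supp_below N (c *: x + y).
Proof.
move=> x0 y0 k Nk; change (c * x k + y k = 0).
by rewrite x0// y0// mulr0 addr0.
Qed.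

Lemma supp_finsec N x : supp_below N (finsec N x).
Proof. exact: cutoff_eq0. Qed.

Lemma supp_mono N M x : (N <= M)%N -> supp_below N x -> supp_below M x.
Proof. by move=> NM x0 k Mk; apply: x0; exact: leq_trans NM Mk. Qed.

(** Upper triangularity: a row [k >= N] has no entry in a column [j < N]. *)
Lemma finsec_local N M x : (N <= M)%N -> supp_below N x -> finsec M x = finsec N x.
Proof.
move=> NM x0; apply/val_inj/funext => k.
change (finsec M x k = finsec N x k); rewrite !finsecE.
have S : section_op M x k = section_op N x k.
  rewrite /section_op !cutoff_id//; last exact: (supp_mono NM).
  congr (_ + _); rewrite (big_cat_nat _ (n := N))//=.
  rewrite [X in _ + X]big_nat_cond [X in _ + X]big1 ?addr0// => j /andP[/andP[Nj _] _].
  by rewrite x0// mulr0.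
rewrite S; case: (ltnP k N) => [kN|Nk]; first by rewrite (leq_trans kN NM).
have -> : section_op N x k = 0; last by case: ifP.
rewrite /section_op x0// cutoff_eq0; last exact: leqW.
rewrite !mulr0 subrr add0r big_nat_cond big1// => j /andP[/andP[_ jN] _].
by rewrite b_eq0 ?mulr0 ?mul0r// ltnW// (leq_trans jN Nk).
Qed.

Lemma supp_dense (x : ellw R) e : 0 < e ->
  exists N y, supp_below N y /\ `|x - y| <= e.
Proof.
move=> e0; have [N xN] := cvgn_dist (@trunc_cvg _ x) e0.
exists N, (trunc_ellw N x); split; first exact: cutoff_eq0.
by rewrite distrC; exact: xN.
Qed.

(* [1 - finsec N] is upper triangular, so back substitution solves it. *)
Lemma finsec_range N y : supp_below N y ->
  exists2 x, supp_below N x & x - finsec N x = y.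
Proof.
elim: N y => [|N IH] y y0.
  exists 0 => //; apply/val_inj/funext => k.
  by rewrite linear0 subr0 [RHS]y0.
have th : 0 < 1 + theta r d a N by rewrite ltr_pwDl.
(* At row [N] only the diagonal entry acts on [e], so this [c] solves the last equation. *)
pose c := y N / (1 + theta r d a N).
pose e := trunc_ellw N.+1 (fun k => if k == N then c else 0).
have eE k : e k = if k == N then c else 0.
  change (cutoff N.+1 (fun k => if k == N then c else 0) k = if k == N then c else 0).
  by rewrite /cutoff; case: ltnP => // Nk; case: eqP => // kN; rewrite kN ltnn in Nk.
have eS : supp_below N.+1 e by exact: cutoff_eq0.
have secN : section_op N.+1 e N = - theta r d a N * c.
  rewrite /section_op cutoff_eq0// eE eqxx mulr0 add0r mulNr.
  rewrite big_nat_cond big1 ?addr0// => j /andP[/andP[_ jN] _].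
  by rewrite b_eq0 ?mulr0 ?mul0r.
have y'S : supp_below N (y - (e - finsec N.+1 e)).
  move=> k Nk; change (y k - (e k - finsec N.+1 e k) = 0).
  rewrite finsecE; move: Nk; rewrite leq_eqVlt => /orP[/eqP <-|Nk]; last first.
    by rewrite y0// eS// ltnNge Nk subrr subrr.
  rewrite ltnSn secN eE eqxx /c mulNr opprK.
  rewrite -{1}(mul1r (y N / _)) -mulrDl [_ * (y N / _)]mulrC divfK ?subrr//.
  by rewrite gt_eqF.
have [x xS xE] := IH _ y'S.
exists (e + x).
  by rewrite -(scale1r e); apply: supp_lin => //; exact: supp_mono xS.
rewrite (linearD (finsec N.+1)) /= (@finsec_local N N.+1 x)// opprD addrACA xE.
by rewrite addrC subrK.
Qed.


(** * The finitely supported sequences as a core *)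

Definition finsec_lin N : {linear ellw R -> ellw R} := finsec N.

Definition finsec_core : set (ellw R * ellw R) := core_graph finsec_lin supp_below.

Lemma frag_row_sum (f : nat -> R) i n :
  \sum_(i.+1 <= j < n) a j * b i j * f j = \sum_(0 <= j < n) a j * b i j * f j.
Proof.
rewrite (@big_nat_widenl _ _ _ _ 0%N)//= big_mkcond.
apply: eq_bigr => j _; case: ltnP => //= ji.
by rewrite b_eq0// mulr0 mul0r.
Qed.

Lemma frag_lim (x : ellw R) i : decay_dom r d a x ->
  \sum_(0 <= j < n) a j * b i j * x j @[n --> \oo] --> frag a b x i.
Proof.
move=> xD; have := frag_cvg (i := i) d_ge0 a0 a_gt0 b_ge0 b_eq0 b_mass xD.
rewrite /frag; set u := (X in cvgn X) => uc.
by rewrite (_ : (fun n => _) = u)//; apply/funext => n; rewrite /u frag_row_sum.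
Qed.

Lemma supp_decay_dom N x : supp_below N x -> decay_dom r d a x.
Proof.
move=> x0; split.
- by apply: (@finsupp_wl1 _ N) => k Nk; rewrite /= x0// mulr0.
- apply: (@finsupp_wl1 _ N.+1) => -[//|k]; rewrite ltnS => Nk /=.
  by rewrite !x0// ?mulr0 ?subrr// leqW.
- apply: cvg_near_cst; exists N => // n /= Nn.
  by rewrite x0// mulr0.
Qed.

Lemma supp_frag N x i : supp_below N x ->
  frag a b x i = \sum_(0 <= j < N) a j * b i j * x j.
Proof.
move=> x0; apply: (cvg_unique _ (frag_lim (i := i) (supp_decay_dom x0))) => //.
apply: cvg_near_cst; exists N => // n /= Nn.
rewrite (big_cat_nat _ (n := N))//= [X in _ + X]big_nat_cond.
rewrite [X in _ + X]big1 ?addr0// => j /andP[/andP[Nj _] _].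
by rewrite x0// mulr0.
Qed.

Lemma finsec_decayfrag N x i : supp_below N x ->
  finsec N x i = decay r d a x i + frag a b x i.
Proof.
move=> x0; rewrite (supp_frag _ x0) finsecE /decay /section_op (cutoff_id x0).
case: ltnP => // Ni; rewrite !x0//; last exact: leqW.
rewrite !mulr0 subrr add0r big_nat_cond big1// => j /andP[/andP[_ jN] _].
by rewrite b_eq0 ?mulr0 ?mul0r// ltnW// (leq_trans jN Ni).
Qed.

Lemma finsec_core_decayfrag : finsec_core `<=` decayfrag r d a b.
Proof.
move=> [x y] [N /= x0 ->]; split; first exact: supp_decay_dom x0.
by move=> i; exact: finsec_decayfrag.
Qed.

Lemma decay_domB x y : decay_dom r d a x -> decay_dom r d a y ->
  decay_dom r d a (x - y).
Proof.
move=> [px tx rx] [py ty ry]; split.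
- rewrite (_ : prate d a \* _ = (prate d a \* x) - (prate d a \* y)) ?rpredB//.
  by apply/funext => k; exact: mulrBr.
- rewrite (_ : triangle _ = triangle (r \* x) - triangle (r \* y)) ?rpredB//.
  apply/funext => k; rewrite -[RHS]/(triangle _ k - triangle _ k).
  case: k => [|k]; first exact: mulrBr.
  change (r k * (x k - y k) - r k.+1 * (x k.+1 - y k.+1) =
    r k * x k - r k.+1 * x k.+1 - (r k * y k - r k.+1 * y k.+1)).
  by ring.
- rewrite -(subrr (0 : R)) (_ : (fun n => _) = (fun n => r n * x n - r n * y n)).
    exact: cvgB.
  by apply/funext => n; exact: mulrBr.
Qed.

(** [wnorm_fatou] reduces the claim to finite square sections, where [frag_sum_le] applies. *)
Lemma frag_le (x : ellw R) (c : R) : decay_dom r d a x ->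
  (wnorm (prate d a \* x)%R <= c%:E)%E -> (wnorm (frag a b x) <= c%:E)%E.
Proof.
move=> xD /wnorm_leP pc.
apply: (@wnorm_fatou _ nat \oo _
  (fun n => cutoff n (fun i => \sum_(0 <= j < n) a j * b i j * x j))).
  move=> i; apply: cvg_trans (frag_lim (i := i) xD); apply: near_eq_cvg => /=.
  by exists i.+1 => // n /= ni; rewrite /cutoff ni.
apply: nearW => n; rewrite (@wnorm_finsupp _ n); last exact: cutoff_eq0.
rewrite wpsum_cutoff lee_fin; apply: le_trans (pc n).
apply: le_trans (_ : _ <= \sum_(0 <= j < n) j.+1%:R * (a j * `|x j|)) _; last first.
  apply: ler_sum => j _; rewrite ler_wpM2l//= normrM ler_wpM2r//.
  by rewrite ger0_norm ?addr_ge0// lerDl.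
apply: le_trans (frag_sum_le n x); apply: ler_sum => i _; rewrite ler_wpM2l//.
apply: le_trans (ler_norm_sum _ _ _) _; apply: ler_sum => j _.
by rewrite normrM ger0_norm// mulr_ge0.
Qed.

Lemma decayfrag_le (x : ellw R) (c c' : R) : decay_dom r d a x ->
  (wnorm (triangle (r \* x)%R) <= c%:E)%E -> (wnorm (prate d a \* x)%R <= c'%:E)%E ->
  (wnorm (decay r d a x + frag a b x)%R <= (c + c' + c')%:E)%E.
Proof.
move=> xD tc pc; apply: wnorm_leD; last exact: frag_le.
have -> : decay r d a x = - ((fun i => triangle (r \* x) i.+1) + prate d a \* x).
  apply/funext => i; rewrite /decay /theta /prate/=.
  transitivity (- (r i * x i - r i.+1 * x i.+1 + (a i + d i) * x i)) => //.
  by ring.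
by apply: wnorm_leN; apply: wnorm_leD => //; exact: wnorm_le_behead.
Qed.

(** Truncations of [x] converge in the norms of [p x] and [triangle (r x)], which control the
    operator by [decayfrag_le]. The condition that [r n * x n] tends to 0 makes the jump at the cut
    harmless. *)
Lemma decayfrag_closure_core : decayfrag r d a b `<=` closure finsec_core.
Proof.
move=> [x g] [/= xD gE]; have [px tx rx] := xD.
apply/closure_prodP => e e0; have e4 : 0 < e / 4 by rewrite divr_gt0.
have [N1 xN] := cvgn_dist (@trunc_cvg _ x) e0.
have [N2 pN] := cvgn_dist (@trunc_cvg _ (Ellw px)) e4.
have [N3 tN] := cvgn_dist (@trunc_cvg _ (Ellw tx)) e4.
set M := maxn N1 (maxn N2 N3).
have [M1 M2 M3] : [/\ (N1 <= M.+1)%N, (N2 <= M.+1)%N & (N3 <= M.+1)%N].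
  by rewrite !leqW// /M !leq_max leqnn ?orbT.
set y := trunc_ellw M.+1 x.
have y0 : supp_below M.+1 y by exact: cutoff_eq0.
have tailE (f : nat -> R) (fX : f \in wl1) : `|trunc_ellw M.+1 f - Ellw fX| <= e / 4 ->
    (wnorm (f - cutoff M.+1 f)%R <= (e / 4)%:E)%E.
  rewrite distrC => fe; change (wnorm (Ellw fX - trunc_ellw M.+1 f)%R <= (e / 4)%:E)%E.
  by rewrite wnormE lee_fin.
exists y, (finsec M.+1 y); split; first by exists M.+1.
  by rewrite distrC; exact: xN.
have yD := supp_decay_dom y0; have hD := decay_domB xD yD.
rewrite -lee_fin -wnormE.
have -> : val (g - finsec M.+1 y) = decay r d a (x - y) + frag a b (x - y).
  apply/funext => i.
  change (g i - finsec M.+1 y i = decay r d a (x - y) i + frag a b (x - y) i).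
  rewrite gE (finsec_decayfrag _ y0).
  have -> : frag a b (x - y) i = frag a b x i - frag a b y i.
    apply: (cvg_unique _ (frag_lim (i := i) hD)) => //.
    rewrite (_ : (fun n => _) = (fun n => \sum_(0 <= j < n) a j * b i j * x j -
        \sum_(0 <= j < n) a j * b i j * y j)).
      exact: cvgB (frag_lim (i := i) xD) (frag_lim (i := i) yD).
    by apply/funext => n; rewrite -sumrB; apply: eq_bigr => j _; exact: mulrBr.
  rewrite /decay -[(x - y) i]/(x i - y i) -[(x - y) i.+1]/(x i.+1 - y i.+1).
  by ring.
(* Two quarters serve [triangle], its tail and its jump; the other two bound [p x], once within
   decay and once for fragmentation. *)
have -> : e = e / 4 + e / 4 + e / 4 + e / 4 by lra.
apply: decayfrag_le => //.
  rewrite (_ : r \* (x - y) = (r \* x) - cutoff M.+1 (r \* x)).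
    by apply: triangle_tail_norm rx _; apply: tailE; exact: tN.
  apply/funext => k; change (r k * (x k - cutoff M.+1 x k) = r k * x k - cutoff M.+1 (r \* x) k).
  by rewrite /cutoff; case: ifP => _ /=; rewrite ?subrr ?mulr0// !subr0.
rewrite (_ : prate d a \* (x - y) = (prate d a \* x) - cutoff M.+1 (prate d a \* x)).
  by apply: tailE; exact: pN.
apply/funext => k.
change (prate d a k * (x k - cutoff M.+1 x k) =
        prate d a k * x k - cutoff M.+1 (prate d a \* x) k).
by rewrite /cutoff; case: ifP => _ /=; rewrite ?subrr ?mulr0// !subr0.
Qed.

Lemma closure_decayfrag : closure (decayfrag r d a b) = closure finsec_core.
Proof.
apply/seteqP; split.
  rewrite [X in _ `<=` X](closure_id _).1; last exact: closed_closure.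
  exact: closure_subset decayfrag_closure_core.
exact: closure_subset finsec_core_decayfrag.
Qed.

(** * The domain of the closure when death dominates fragmentation *)

Section relatively_bounded_fragmentation.
Variables (K C : R).
Hypothesis K_ge0 : 0 <= K.
Hypothesis C_ge0 : 0 <= C.
Hypothesis prate_le : forall i, prate d a i <= K * d i + C.

Lemma norm_finsec N (x : ellw R) : `|finsec N x| = wpsum N (section_op N x).
Proof. exact: norm_trunc. Qed.

Lemma core_prate_le N x : supp_below N x ->
  (wnorm (prate d a \* x)%R <= (K * `|finsec N x| + C * `|x|)%:E)%E.
Proof.
move=> x0; rewrite (@wnorm_finsupp _ N); last by move=> k Nk /=; rewrite x0// mulr0.
rewrite lee_fin norm_finsec.
have := ler_wpM2l K_ge0 (death_le N x); have := ler_wpM2l C_ge0 (wpsum_le N x).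
suff : wpsum N (prate d a \* x) <=
    K * \sum_(0 <= i < N) i.+1%:R * (d i * `|x i|) + C * wpsum N x by lra.
rewrite /wpsum !mulr_sumr -big_split /=; apply: ler_sum => i _.
have p0 : 0 <= prate d a i by rewrite addr_ge0.
rewrite normrM (ger0_norm p0).
have -> : K * (i.+1%:R * (d i * `|x i|)) + C * (i.+1%:R * `|x i|) =
    i.+1%:R * ((K * d i + C) * `|x i|) by ring.
by rewrite ler_wpM2l// ler_wpM2r.
Qed.

(* The value is a sum of crude bounds; only its independence of [N] and [x] matters. *)
Definition graph_const : R := r 0%N + 2 * (2 * (K + C) + 1).

(** Fragmentation is bounded by [p x], which [core_prate_le] controls; subtracting it leaves decay,
    and adding [p x] to decay gives minus the shifted [triangle]. *)
Lemma core_triangle_le N x : supp_below N x ->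
  (wnorm (triangle (r \* x)%R) <= (graph_const * (`|finsec N x| + `|x|))%:E)%E.
Proof.
move=> x0.
have xD := supp_decay_dom x0; have px := core_prate_le x0.
set c := K * _ + _ in px; set L := `|finsec N x| in c px *.
have dx : (wnorm (decay r d a x) <= (L + c)%:E)%E.
  have -> : decay r d a x = val (finsec N x) - frag a b x.
    apply/funext => i.
    change (decay r d a x i = finsec N x i - frag a b x i).
    by rewrite (finsec_decayfrag _ x0) addrK.
  apply: wnorm_leD; last by apply: wnorm_leN; exact: frag_le.
  by rewrite wnormE.
have bx : (wnorm (fun k => triangle (r \* x)%R k.+1) <= (L + c + c)%:E)%E.
  have -> : (fun k => triangle (r \* x) k.+1) = - (decay r d a x + prate d a \* x).
    apply/funext => i.
    change (r i * x i - r i.+1 * x i.+1 =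
      - (r i.+1 * x i.+1 - (r i + a i + d i) * x i + (a i + d i) * x i)).
    by ring.
  by apply: wnorm_leN; exact: wnorm_leD.
have h0 : `|triangle (r \* x) 0%N| <= r 0%N * `|x|.
  by rewrite /= normrM (ger0_norm (ltW (r_gt0 _))) ler_wpM2l ?ellw_coord_le// ltW.
apply: le_trans (wnorm_le_cons h0 bx) _.
rewrite lee_fin /graph_const /c.
have L0 : 0 <= L := normr_ge0 _. have X0 := normr_ge0 x.
have := mulr_ge0 (ltW (r_gt0 0)) L0; have := mulr_ge0 (ltW (r_gt0 0)) X0.
have := mulr_ge0 K_ge0 X0; have := mulr_ge0 C_ge0 L0.
have := mulr_ge0 K_ge0 L0; have := mulr_ge0 C_ge0 X0.
lra.
Qed.

(** Uniformity in [i] and [N] is the point: the vanishing of [r n * x n] at infinity does not follow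
    from a Fatou argument. *)
Lemma core_decay_le N x i : supp_below N x ->
  r i * `|x i| <= graph_const * (`|finsec N x| + `|x|).
Proof.
move=> x0; have [_ _ rx] := supp_decay_dom x0.
have := triangle_tail (M := i) rx (wnorm_le_tail i.+1 (core_triangle_le x0)).
rewrite normrM (ger0_norm (ltW (r_gt0 _))); apply: le_trans.
by rewrite ler_peMl ?ler1n// mulr_ge0// ltW.
Qed.

(** The two norm conditions pass to the limit by [wnorm_fatou]; the vanishing of [r n * x n] uses
    [core_decay_le] on the difference of two approximants. *)
Lemma closure_core_dom (x g : ellw R) : closure finsec_core (x, g) -> decay_dom r d a x.
Proof.
move=> /closure_prodP clx.
have gc0 : 0 <= graph_const.
  by rewrite /graph_const; have := r_gt0 0; move: K_ge0 C_ge0; lra.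
have approx e : 0 < e -> exists N y,
    [/\ supp_below N y, `|x - y| <= e & `|g - finsec N y| <= e].
  by move=> /clx[y [z [[N /= y0 ->] xy gz]]]; exists N, y.
have /choice[y yP] : forall n, exists y : ellw R, exists N,
    [/\ supp_below N y, `|x - y| <= n.+1%:R^-1 & `|g - finsec N y| <= n.+1%:R^-1].
  by move=> n; have [|N [y h]] := approx n.+1%:R^-1; [|exists y, N].
have yx k : y n k @[n --> \oo] --> x k.
  have yx : y n @[n --> \oo] --> x.
    apply/subr_cvg0/norm_cvg0P.
    apply: (@squeeze_cvgr _ _ _ _ (cst 0) (@harmonic R)).
    - apply: nearW => n; rewrite normr_ge0 distrC /=.
      by have [N []] := yP n.
    - exact: cvg_cst.
    - exact: cvg_harmonic.
  exact: (@continuous_cvg _ _ _ \oo _ y (fun z : ellw R => z k) x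
    (@ellw_coord_continuous _ k x) yx).
have bd n : exists2 N, supp_below N (y n) & `|finsec N (y n)| + `|y n| <= `|x| + `|g| + 2.
  have [N [y0 xy gy]] := yP n; exists N => //.
  have n1 : n.+1%:R^-1 <= 1 :> R by rewrite invf_le1// ler1n.
  have := ler_normB x (x - y n); have := ler_normB g (g - finsec N (y n)).
  by rewrite !subKr; move: (le_trans xy n1) (le_trans gy n1); lra.
split.
- apply: (@wl1P _ _ ((K + C) * (`|x| + `|g| + 2))).
  apply: (@wnorm_fatou _ nat \oo _ (fun n => prate d a \* y n)).
    by move=> k; apply: cvgMr; exact: yx.
  apply: nearW => n; have [N y0 yn] := bd n.
  apply: le_trans (core_prate_le y0) _; rewrite lee_fin.
  apply: le_trans (ler_wpM2l (addr_ge0 K_ge0 C_ge0) yn).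
  have := mulr_ge0 K_ge0 (normr_ge0 (y n)).
  have := mulr_ge0 C_ge0 (normr_ge0 (finsec N (y n))); lra.
- apply: (@wl1P _ _ (graph_const * (`|x| + `|g| + 2))).
  apply: (@wnorm_fatou _ nat \oo _ (fun n => triangle (r \* y n))).
    move=> [|k] /=; first by apply: cvgMr; exact: yx.
    by apply: cvgB; apply: cvgMr; exact: yx.
  apply: nearW => n; have [N y0 yn] := bd n.
  apply: le_trans (core_triangle_le y0) _; rewrite lee_fin.
  exact: ler_wpM2l.
apply/cvgrPdist_le => e e0.
(* Two approximants within [s] of [x] in graph norm differ by at most [4 * s] in the sum of both
   norms, so [core_decay_le] yields at most [e / 2]. *)
pose s := e / 2 / (4 * graph_const + 1).
have s0 : 0 < s by rewrite !divr_gt0// ltr_wpDl// mulr_ge0.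
have [N [y1 [y10 xy1 gy1]]] := approx s s0.
exists N => // i /= Ni; rewrite sub0r normrN.
(* The second approximant depends on [i], since [r i] may be unbounded. As [y1] vanishes at [i], the
   coordinate [y2 i] is that of [y2 - y1]. *)
pose s' := Num.min s (e / 2 / r i).
have s'0 : 0 < s' by rewrite lt_min s0 !divr_gt0.
have [N' [y2 [y20 xy2 gy2]]] := approx s' s'0.
have [s's s'e] : s' <= s /\ s' <= e / 2 / r i.
  by split; rewrite /s' ge_min lexx ?orbT.
set M := maxn N N'.
have y1M : supp_below M y1 by apply: supp_mono y10; rewrite leq_maxl.
have y2M : supp_below M y2 by apply: supp_mono y20; rewrite leq_maxr.
have yM : supp_below M (y2 - y1).
  by rewrite addrC -scaleN1r; exact: supp_lin.
have T : finsec M (y2 - y1) = finsec N' y2 - finsec N y1.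
  rewrite -(@finsec_local N M y1) ?leq_maxl// -(@finsec_local N' M y2) ?leq_maxr//.
  exact: (linearB (finsec_lin M)).
have := core_decay_le i yM; rewrite T.
have -> : (y2 - y1) i = y2 i by rewrite -[LHS]/(y2 i - y1 i) y10// subr0.
move=> yi.
have n1 : `|finsec N' y2 - finsec N y1| <= s + s.
  apply: le_trans (ler_distD g _ _) _; rewrite lerD//.
  by rewrite distrC (le_trans gy2).
have n2 : `|y2 - y1| <= s + s.
  apply: le_trans (ler_distD x _ _) _; rewrite lerD//.
  by rewrite distrC (le_trans xy2).
have ri0 := ltW (r_gt0 i).
have xi : r i * `|x i - y2 i| <= e / 2.
  apply: le_trans (ler_wpM2l ri0 (_ : _ <= e / 2 / r i)) _.
    by apply: le_trans (ellw_coord_le (x - y2) i) _; exact: le_trans xy2 s'e.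
  by rewrite mulrC divfK// gt_eqF.
rewrite normrM (ger0_norm ri0) -(subrK (y2 i) (x i)).
apply: le_trans (ler_wpM2l ri0 (ler_normD _ _)) _.
rewrite mulrDr [leRHS](splitr e) lerD//; apply: le_trans yi _.
apply: le_trans (ler_wpM2l gc0 (lerD n1 n2)) _.
have : s * (4 * graph_const + 1) = e / 2.
  by rewrite /s divfK// gt_eqF// ltr_wpDl// mulr_ge0.
by lra.
Qed.

End relatively_bounded_fragmentation.

Lemma limn_esup_prate_le :
  (\forall n \near \oo, 0 < d n) -> (limn_esup (fun n => (a n / d n)%:E) < +oo)%E ->
  exists K C, [/\ 0 <= K, 0 <= C & forall i, prate d a i <= K * d i + C].
Proof.
move=> [N0 _ dN]; rewrite limn_esup_lim (cvg_lim _ (@cvg_esups_inf R _))//.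
move=> /ereal_inf_lt[_ [N1 _ <-]] supN.
have uN n : (N1 <= n)%N ->
    ((a n / d n)%:E <= esups (fun n => (a n / d n)%:E) N1)%E.
  by move=> N1n; apply: ereal_sup_ubound; exists n.
have [k kN] : exists k : R, forall n, (N1 <= n)%N -> a n / d n <= k.
  (* The value [+oo] is excluded by [supN], and [-oo] contradicts [uN]. *)
  move: supN uN; case: (esups _ N1) => [k| |] // _ uN.
  - by exists k => n /uN; rewrite lee_fin.
  - by exists 0 => n /uN.
(* The 1 accounts for the [d] in [prate]; the sum covers the initial indices, where [d] may vanish
   or the ratio exceed [k]. *)
exists (Num.max 0 k + 1), (\sum_(0 <= i < maxn N0 N1) a i).
have k0 : 0 <= Num.max 0 k by rewrite le_max lexx.
split; [by rewrite addr_ge0|by rewrite sumr_ge0|move=> i].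
rewrite /prate mulrDl mul1r addrAC lerD2r.
case: (ltnP i (maxn N0 N1)) => iN.
  apply: ler_wpDl; first by rewrite mulr_ge0.
  rewrite (big_cat_nat _ (n := i))//=; last exact: ltnW.
  apply: ler_wpDl; first by rewrite sumr_ge0.
  by rewrite big_ltn// lerDl sumr_ge0.
apply: ler_wpDr; first by rewrite sumr_ge0.
move: iN; rewrite geq_max => /andP[N0i N1i].
by rewrite -ler_pdivrMr ?dN// le_max kN// orbT.
Qed.

End finite_sections.

Theorem theorem2p9 (R : realType) (r d a : nat -> R) (b : nat -> nat -> R)
  (r_gt0 : forall i, 0 < r i)
  (d_ge0 : forall i, 0 <= d i)
  (a0 : a 0%N = 0)
  (a_gt0 : forall i, (0 < i)%N -> 0 < a i)
  (b_ge0 : forall i j, 0 <= b i j)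
  (b_eq0 : forall i j, (j <= i)%N -> b i j = 0)
  (b_mass : forall j, (0 < j)%N ->
    \sum_(0 <= i < j) i.+1%:R * b i j = j.+1%:R) :
  [/\ closable (decayfrag r d a b),
      exists S : R -> ellw R -> ellw R,
        substochastic_semigroup S /\
        generator S = closure (decayfrag r d a b) &
      (\forall n \near \oo, 0 < d n) ->
      (limn_esup (fun n => (a n / d n)%:E) < +oo)%E ->
      opdom (closure (decayfrag r d a b)) = decay_dom r d a].
Proof.
pose T := finsec_lin r d a b.
have clE : closure (decayfrag r d a b) = closure (finsec_core r d a b).
  exact: closure_decayfrag.
have contr N : exists2 h, 0 < h &
    forall k x, 0 <= k -> k <= h -> `|euler_step (T N) k x| <= `|x|.
  exists (sec_step r d a N); first exact: sec_step_gt0.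
  by move=> k x; exact: finsec_contr.
have lin := @supp_lin R.
have inv N x : supp_below N x -> supp_below N (T N x) by move=> _; exact: supp_finsec.
have loc N M x : (N <= M)%N -> supp_below N x -> T M x = T N x.
  exact: finsec_local.
have dense := @supp_dense R.
have range N y : supp_below N y -> exists2 x, supp_below N x & x - T N x = y.
  exact: finsec_range.
split.
- move=> x y z; rewrite clE => xy xz.
  exact: (closable_core contr lin inv loc dense xy xz).
- exists (lsg T); split; last by rewrite clE; exact: generator_closure_core.
  split; first exact: (lsg_C0 contr lin inv loc dense).
    (* The nonnegative cone is closed, being an intersection of preimages of half-lines under
       coordinates, and small Euler steps preserve it. *)
    move=> t f t0 f0; pose P := [set x : ellw R | forall k, 0 <= x k].
    have clP : closed P.
      rewrite (_ : P = \bigcap_k ((fun x : ellw R => x k) @^-1` [set y | 0 <= y])).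
        apply: closed_bigI => k _; apply: closed_comp; last exact: closed_ge.
        by move=> x _; exact: ellw_coord_continuous.
      by apply/seteqP; split => [x h k _|x h k]; exact: h.
    apply: (lsg_closed contr lin inv loc dense t0 clP _ f0) => N.
    exists (sec_step r d a N); first exact: sec_step_gt0.
    by move=> k y k0 kN y0; exact: finsec_nonneg.
  by move=> t f t0; exact: (lsg_contr contr lin inv loc dense).
move=> dN sup.
have [K [C [K0 C0 pKC]]] := limn_esup_prate_le d_ge0 a0 a_gt0 dN sup.
apply/seteqP; split => [x [[x' g] /= xg <-]|x xD].
  rewrite clE in xg.
  exact: (closure_core_dom r_gt0 d_ge0 a0 a_gt0 b_ge0 b_eq0 b_mass K0 C0 pKC xg).
(* The converse inclusion holds because [decay_dom] is already the domain of the unclosed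
   operator. *)
rewrite -(opdom_decayfrag r d_ge0 a0 a_gt0 b_ge0 b_eq0 b_mass) in xD.
by have [xg xgG <-] := xD; exists xg => //; exact: subset_closure.
Qed.
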